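(* For every natural number $d>1$ the number $\mathfrak{c}_d^{\mathrm{pol}}$ is finite, and $$\mathfrak{c}_d^{\mathrm{pol}}\le O\bigl(d^5\bigr)\Bigl(\tfrac32\Bigr)^{\lceil\sqrt{d-1}\,\rceil(d-1)},$$ i.e. there is an absolute constant $K>0$ such that $\mathfrak{c}_d^{\mathrm{pol}}\le K\,d^5\,(3/2)^{\lceil\sqrt{d-1}\rceil(d-1)}$ for all $d>1$.
   Context: A lattice polytope in $\mathbb{R}^d$ is a convex polytope whose vertices lie in $\mathbb{Z}^d$. For $c\ge 0$, $cP$ denotes the image of $P$ under the dilatation with factor $c$ and center the origin $O$. For a lattice simplex with vertices $v_0,\dots,v_e$, its multiplicity is the index of the subgroup $U$ generated by $v_1-v_0,\dots,v_e-v_0$ in the smallest direct summand of $\mathbb{Z}^d$ containing $U$; a lattice simplex is unimodular if its multiplicity is $1$. For a $d$-polytope $P\subset\mathbb{R}^d$, $\mathrm{UC}(P)$ is the union of all unimodular lattice $d$-simplices contained in $P$. $\mathfrak{c}_d^{\mathrm{pol}}$ is the infimum of natural numbers $c$ such that $c'P=\mathrm{UC}(c'P)$ for all lattice $d$-polytopes $P\subset\mathbb{R}^d$ and all natural numbers $c'\ge c$ (a priori possibly $\infty$). *)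

(* Defs.v *)
From HB Require Import structures.
From mathcomp Require Import all_boot all_order all_algebra.
From mathcomp Require Import reals.
Set Implicit Arguments. Unset Strict Implicit. Unset Printing Implicit Defensive.
Import Order.TTheory GRing.Theory Num.Theory.
Local Open Scope ring_scope.

Definition lpt (R : realType) (d : nat) (z : 'I_d -> int) : 'I_d -> R :=
  fun j => (z j)%:~R.

Definition conv (R : realType) (d n : nat) (v : 'I_n -> 'I_d -> R)
  (x : 'I_d -> R) : Prop :=
  exists w : 'I_n -> R, (forall i, 0 <= w i) /\ \sum_(i < n) w i = 1 /\
    forall j, x j = \sum_(i < n) w i * v i j.

Definition lattice_polytope (R : realType) (d : nat) (P : ('I_d -> R) -> Prop) : Prop :=
  exists n (v : 'I_n -> 'I_d -> int), (0 < n)%N /\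
    forall x, P x <-> conv (fun i => lpt R (v i)) x.

Definition full_dim (R : realType) (d : nat) (P : ('I_d -> R) -> Prop) : Prop :=
  exists (x0 : 'I_d -> R) (x : 'I_d -> 'I_d -> R),
    P x0 /\ (forall i, P (x i)) /\ \det (\matrix_(i, j) (x i j - x0 j)) != 0.

(* lattice d-simplex with vertices v 0, ..., v d of multiplicity 1: the differences
   v_i - v_0 generate Z^d (for a d-simplex, the smallest direct summand of Z^d
   containing them is Z^d itself) *)
Definition unimodular (d : nat) (v : 'I_d.+1 -> 'I_d -> int) : Prop :=
  forall z : 'I_d -> int, exists c : 'I_d -> int, forall j,
    z j = \sum_(i < d) c i * (v (lift ord0 i) j - v ord0 j).

Definition UC (R : realType) (d : nat) (P : ('I_d -> R) -> Prop) (x : 'I_d -> R) : Prop :=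
  exists v : 'I_d.+1 -> 'I_d -> int, unimodular v /\
    (forall y, conv (fun i => lpt R (v i)) y -> P y) /\
    conv (fun i => lpt R (v i)) x.

Definition dil (R : realType) (d : nat) (c : R) (P : ('I_d -> R) -> Prop) (x : 'I_d -> R) : Prop :=
  exists y, P y /\ forall j, x j = c * y j.

(* c belongs to the set whose infimum is c_d^pol: c'P = UC(c'P) for all lattice
   d-polytopes P and all natural c' >= c *)
Definition cpol_admissible (R : realType) (d c : nat) : Prop :=
  forall c' : nat, (c <= c')%N -> forall P : ('I_d -> R) -> Prop,
    lattice_polytope P -> full_dim P ->
    forall x, dil (c'%:R) P x <-> UC (dil (c'%:R) P) x.

(* Main.v *)
Require Import Defs.
From mathcomp Require Import all_boot all_order all_algebra.
From mathcomp Require Import all_fingroup.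
From mathcomp Require Import classical_sets reals.
From mathcomp Require Import zify ring lra.
Set Implicit Arguments. Unset Strict Implicit. Unset Printing Implicit Defensive.
Import Order.TTheory GRing.Theory Num.Theory.
Local Open Scope ring_scope.

(** Every point of a multiple cP lies in some simplex spanned by vertices of P. Near the vertex with
    the largest barycentric coordinate the question is about a simplicial cone: each of its points
    must lie in a unimodular subcone whose generators are bounded, in the coordinates given by the
    edges, by a constant depending only on d. The unimodular cone is tiled by unimodular simplices,
    and for large c the one around the given point stays inside cP.

    For cones, project along the generator e on which x has its largest coordinate, and lift the
    basis obtained by induction for the projection. If the resulting basis e, u_1, ..., u_(d-1) does
    not have x in its cone, then only the coefficient of e is negative. The u_k with small
    coefficients are kept. For the others, rescale so that x becomes the all-ones vector; e and the
    u_k then have bounded entries, and an LLL-reduced basis of their lattice yields a narrow cone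
    around x, of index a power of 2. Halving even combinations of the generators makes it
    unimodular. The resulting constant is 2^O(d log^2 d), which is eventually smaller than the
    required bound. *)

(** * Cones generated by matrix rows, and halving the index of a cone *)

Local Notation "A ^r" := (map_mx intr A) (at level 2, left associativity, format "A ^r").

Definition nneg (R : realType) (m n : nat) (A : 'M[R]_(m, n)) : Prop :=
  forall i j, 0 <= A i j.

Definition in_cone (R : realType) (m n : nat) (A : 'M[R]_(m, n)) (x : 'rV[R]_n) : Prop :=
  exists2 a : 'rV[R]_m, nneg a & x = a *m A.

Definition set_row (K : nzRingType) (m n : nat) (k : 'I_m) (v : 'rV[K]_n) (A : 'M[K]_(m, n)) :=
  \matrix_(i, j) (if i == k then v 0 j else A i j).

Lemma det_set_row1 (K : comNzRingType) (n : nat) (k : 'I_n) (s : 'rV[K]_n) :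
  \det (set_row k s 1%:M) = s 0 k.
Proof.
rewrite (expand_det_row _ k) (bigD1 k) //= big1 => [|j jk].
  rewrite /cofactor mxE eqxx addr0 exprD -expr2 sqrr_sign mul1r.
  suff -> : row' k (col' k (set_row k s 1%:M)) = 1%:M by rewrite det1 mulr1.
  by apply/matrixP=> a b; rewrite !mxE eq_sym (negPf (neq_lift _ _)) (inj_eq (@lift_inj _ k)).
have -> : cofactor (set_row k s 1%:M) k j = cofactor (1%:M : 'M[K]_n) k j.
  congr (_ * \det _); apply/matrixP=> a b; rewrite !mxE.
  by rewrite eq_sym (negPf (neq_lift _ _)).
have -> : cofactor (1%:M : 'M[K]_n) k j = (\adj 1%:M : 'M[K]_n) j k by rewrite mxE.
have -> : (\adj 1%:M : 'M[K]_n) = 1%:M by rewrite -[LHS]mul1mx mul_mx_adj det1.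
by rewrite [X in _ * X]mxE (negPf jk) mulr0.
Qed.

Lemma set_row_mul (K : comNzRingType) (m n : nat) (k : 'I_m) (s : 'rV[K]_m) (A : 'M[K]_(m, n)) :
  set_row k s 1%:M *m A = set_row k (s *m A) A.
Proof.
apply/matrixP=> i j; rewrite !mxE; case: (eqVneq i k) => [->|ik].
  by apply: eq_bigr => l _; rewrite mxE eqxx.
rewrite (bigD1 i) //= big1 ?addr0 => [|l li].
  by rewrite mxE (negPf ik) mxE eqxx mul1r.
by rewrite mxE (negPf ik) mxE eq_sym (negPf li) mul0r.
Qed.

Lemma det_set_row (K : comNzRingType) (n : nat) (k : 'I_n) (s : 'rV[K]_n) (A : 'M[K]_n) :
  \det (set_row k (s *m A) A) = s 0 k * \det A.
Proof. by rewrite -set_row_mul det_mulmx det_set_row1. Qed.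

(** Modulo 2 the matrix becomes singular over ['F_2], and [s] is the support of a nonzero vector in
    its left kernel. *)
Lemma even_det_row (n : nat) (G : 'M[int]_n) : (2 %| \det G)%Z ->
  exists2 s : 'I_n -> bool, exists k, s k &
    exists v : 'rV[int]_n, (\row_k (s k)%:Z) *m G = 2 *: v.
Proof.
pose phi (z : int) : 'F_2 := z%:~R.
have phi0 z : (phi z == 0) = (2 %| z)%Z by rewrite (dvdz_pcharf (pchar_Fp (isT : prime 2))).
rewrite -phi0 /phi -det_map_mx => /det0P[v v0 vG].
pose s i := v 0 i != 0.
exists s.
  case/rV0Pn: v0 => k vk; by exists k.
have vs i : v 0 i = phi (s i)%:Z.
  rewrite /s /phi; case: (v 0 i) => -[|[|//]] ? //=; apply: val_inj => //.
pose w := (\row_k (s k)%:Z) *m G.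
have ev j : (2 %| w ord0 j)%Z.
  rewrite -phi0 /phi; have /rowP/(_ j) := vG; rewrite !mxE => e.
  rewrite rmorph_sum /= -[X in _ == X]e; apply/eqP/eq_bigr => i _.
  by rewrite rmorphM /= !mxE vs.
exists (\row_j (w ord0 j %/ 2)%Z).
apply/rowP => j; rewrite [RHS]mxE [X in _ = _ * X]mxE mulrC divzK //; exact: ev.
Qed.

(* Halving the even combination [s *m G] and exchanging it for the row of its support with the
   least coefficient divides the index by 2. *)
Lemma halving (R : realType) (n m : nat) (r : nat) (G : 'M[int]_n) (N : 'M[R]_(n, m))
    (T : R) (x : 'rV[R]_m) :
  `|\det G| = 2 ^+ r -> nneg (G^r *m N) -> (forall i j, (G^r *m N) i j <= T) ->
  in_cone (G^r *m N) x ->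
  exists U : 'M[int]_n, [/\ U \in unitmx, nneg (U^r *m N),
    forall i j, (U^r *m N) i j <= n%:R ^+ r * T & in_cone (U^r *m N) x].
Proof.
elim: r G T => [|r IH] G T detG G0 GT Gx.
  exists G; split=> //; last by move=> i j; rewrite expr0 mul1r.
  by rewrite unitmxE; move: detG; rewrite expr0; case: (\det G) => [[|[]]|[]].
have [|s [k0 sk0] [v sGv]] := @even_det_row n G.
  have -> : \det G = (-1) ^+ (\det G < 0)%R * `|\det G| by rewrite -realEsign ?num_real.
  by rewrite detG exprS dvdz_mull // dvdz_mulr.
case: Gx => a a0 xa.
(* Taking [k] with the least coefficient in the support keeps the coefficients [a 0 i - a 0 k] of
   the other rows of the support nonnegative. *)
have [k sk kmin] : exists2 k, s k & forall i, s i -> a 0 k <= a 0 i.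
  by case: (Order.TotalTheory.arg_minP (fun i => a 0 i) sk0) => k sk h; exists k.
pose sr : 'rV[int]_n := \row_k (s k)%:Z.
pose G' := set_row k v G.
have n0 : (0 < n)%N by exact: leq_ltn_trans (ltn_ord k).
have vN : v^r *m N = 2^-1 *: (sr^r *m (G^r *m N)).
  rewrite mulmxA -map_mxM sGv scalemxAl; congr (_ *m _).
  by apply/matrixP => i j; rewrite !mxE rmorphM /= mulKf // pnatr_eq0.
have rowG' i : row i (G'^r *m N) = if i == k then v^r *m N else row i (G^r *m N).
  rewrite row_mul; case: eqP => [->|ik].
    by congr (_ *m _); apply/rowP => j; rewrite !mxE eqxx.
  by rewrite row_mul; congr (_ *m _); apply/rowP => j; rewrite !mxE; case: eqP.
have G'E i j : (G'^r *m N) i j = if i == k then (v^r *m N) 0 j else (G^r *m N) i j.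
  by have /rowP/(_ j) := rowG' i; rewrite mxE => ->; case: ifP => //; rewrite mxE.
have vE j : (v^r *m N) 0 j = 2^-1 * \sum_i (s i)%:R * (G^r *m N) i j.
  rewrite vN mxE; congr (_ * _); rewrite mxE; apply: eq_bigr => i _.
  by rewrite !mxE; case: (s i).
have T0 (j : 'I_m) : 0 <= T by exact: (le_trans (G0 k j) (GT k j)).
have [||||U [Uu U0 UT Ux]] := IH G' (n%:R * T).
(* Putting [2 *: v] into row [k] keeps the determinant, as [s k] is 1; taking out the factor 2
   leaves [\det G']. *)
- have : `|\det (set_row k (sr *m G) G)| = 2 ^+ r.+1 by rewrite det_set_row mxE sk mul1r.
  rewrite sGv; have -> : set_row k (2 *: v) G = set_row k (2 *: delta_mx 0 k) 1%:M *m G'.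
    rewrite set_row_mul; apply/matrixP=> i j; rewrite !mxE; case: eqP => // _.
    rewrite (bigD1 k) //= big1 ?addr0 => [|l lk]; first by rewrite !mxE !eqxx mulr1.
    by rewrite !mxE (negPf lk) andbF mulr0 mul0r.
  rewrite det_mulmx det_set_row1 !mxE !eqxx mulr1 normrM exprS => /mulfI; exact.
- move=> i j; rewrite G'E; case: ifP => // _; rewrite vE mulr_ge0 ?invr_ge0 //.
  by apply: sumr_ge0 => l _; rewrite mulr_ge0 ?ler0n.
- move=> i j; rewrite G'E; case: ifP => _.
    rewrite vE; apply: (@le_trans _ _ (\sum_(i < n) T)).
      apply: le_trans (_ : \sum_i (s i)%:R * (G^r *m N) i j <= _).
        rewrite ler_piMl ?invf_le1 ?ler1n //.
        by apply: sumr_ge0 => l _; rewrite mulr_ge0 ?ler0n.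
      apply: ler_sum => l _; case: (s l); rewrite ?mul1r ?mul0r //; exact: T0.
    by rewrite sumr_const card_ord mulr_natl.
  apply: le_trans (GT i j) _; by rewrite ler_peMl ?(T0 j) // ler1n.
(* As [2 *: v] is the sum of the rows in the support, [a 0 k] times this sum is replaced by
   [2 * a 0 k] times [v]. *)
- pose a' := \row_i (if i == k then 2 * a 0 k else a 0 i - a 0 k * (s i)%:R).
  have a'E i : a' 0 i = if i == k then 2 * a 0 k else a 0 i - a 0 k * (s i)%:R.
    by rewrite mxE.
  exists a'.
    move=> z i; rewrite ord1 a'E; case: eqP => _; first by rewrite mulr_ge0.
    case si: (s i); first by rewrite mulr1 subr_ge0 kmin.
    by rewrite mulr0 subr0.
  rewrite xa; apply/rowP => j; rewrite [LHS]mxE [RHS]mxE.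
  rewrite [RHS](bigD1 k) //= a'E G'E eqxx vE.
  have -> : 2 * a 0 k * (2^-1 * \sum_i (s i)%:R * (G^r *m N) i j) =
            a 0 k * \sum_i (s i)%:R * (G^r *m N) i j by field.
  rewrite (bigD1 k) //= [X in _ = _ * X + _](bigD1 k) //= sk mul1r mulrDr -addrA.
  congr (_ + _); rewrite mulr_sumr -big_split; apply: eq_bigr => i ik /=.
  by rewrite a'E G'E (negPf ik); ring.
exists U; split=> // i j; by rewrite exprSr -mulrA.
Qed.


(** * Orthogonal projection and lattice basis reduction *)

Definition sqnorm (R : realType) (m : nat) (v : 'rV[R]_m) : R := \sum_i v 0 i ^+ 2.

Definition dotp (R : realType) (m : nat) (u v : 'rV[R]_m) : R := \sum_i u 0 i * v 0 i.

Lemma sqnorm_ge0 (R : realType) (m : nat) (v : 'rV[R]_m) : 0 <= sqnorm v.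
Proof. by apply: sumr_ge0 => i _; exact: sqr_ge0. Qed.

Lemma sqr_le_sqnorm (R : realType) (m : nat) (v : 'rV[R]_m) i : v 0 i ^+ 2 <= sqnorm v.
Proof.
by rewrite /sqnorm (bigD1 i) //= lerDl; apply: sumr_ge0 => j _; exact: sqr_ge0.
Qed.

(** For nonzero [b], the orthogonal projection along [b], as a matrix acting on row vectors from the
    right. *)
Definition orth (R : realType) (m : nat) (b : 'rV[R]_m) : 'M[R]_m :=
  1%:M - (sqnorm b)^-1 *: (b^T *m b).

Lemma orthE (R : realType) (m : nat) (b v : 'rV[R]_m) :
  v *m orth b = v - (dotp v b / sqnorm b) *: b.
Proof.
rewrite mulmxBr mulmx1 -scalemxAr mulmxA; congr (_ - _).
have -> : v *m b^T = (dotp v b)%:M.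
  apply/matrixP => i j; rewrite !ord1 !mxE mulr1n.
  by apply: eq_bigr => l _; rewrite mxE.
by rewrite mul_scalar_mx scalerA mulrC.
Qed.

(** Pythagoras: [v *m orth b] is orthogonal to [b]. *)
Lemma sqnorm_orth (R : realType) (m : nat) (b v : 'rV[R]_m) (s : R) : 0 < sqnorm b ->
  sqnorm (v *m orth b + s *: b) = sqnorm (v *m orth b) + s ^+ 2 * sqnorm b.
Proof.
move=> b0; have vb : dotp (v *m orth b) b = 0.
  rewrite orthE; set t := _ / _.
  have -> : dotp (v - t *: b) b = dotp v b - t * sqnorm b.
    by rewrite /dotp /sqnorm mulr_sumr -sumrB; apply: eq_bigr => i _; rewrite !mxE; ring.
  by rewrite divfK ?subrr ?gt_eqF.
rewrite /sqnorm mulr_sumr; set w := v *m orth b in vb *.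
transitivity (\sum_i w 0 i ^+ 2 + \sum_i s ^+ 2 * b 0 i ^+ 2 + s *+ 2 * dotp w b).
  by rewrite /dotp mulr_sumr -!big_split; apply: eq_bigr => i _; rewrite /= !mxE; ring.
by rewrite vb mulr0 addr0.
Qed.

Lemma mul_row_col1 (R : realType) (n m : nat) (c : 'rV[R]_(1 + n)) (A : 'rV[R]_m) (B : 'M[R]_(n, m)) :
  c *m col_mx A B = c 0 (lshift n 0) *: A + rsubmx c *m B.
Proof.
rewrite -[c in LHS]hsubmxK mul_row_col; congr (_ + _); rewrite -mul_scalar_mx; congr (_ *m _).
by apply/rowP => i; rewrite !ord1 !mxE mulr1n.
Qed.

Lemma orth_self (R : realType) (m : nat) (b : 'rV[R]_m) : 0 < sqnorm b -> b *m orth b = 0.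
Proof. by move=> b0; rewrite orthE divff ?scale1r ?subrr ?gt_eqF. Qed.

Lemma sqnorm_decomp (R : realType) (m : nat) (b v : 'rV[R]_m) : 0 < sqnorm b ->
  sqnorm v = sqnorm (v *m orth b) + (dotp v b / sqnorm b) ^+ 2 * sqnorm b.
Proof. by move=> b0; rewrite -sqnorm_orth // orthE subrK. Qed.

Lemma unitmx_row_neq0 (n : nat) (U : 'M[int]_n) k : U \in unitmx -> row k U != 0.
Proof.
move=> Uu; apply/eqP => rk; have /rowP/(_ k) : row k (U *m invmx U) = row k 1%:M by rewrite mulmxV.
by rewrite row_mul rk mul0mx !mxE eqxx.
Qed.

(** A right inverse [D] of [N] recovers the integer coordinates [u], so those of a very short vector
    have absolute value below 1 and vanish. *)
Lemma lattice_sqnorm_bound (R : realType) (n m : nat) (N : 'M[R]_(n, m)) : row_free N ->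
  exists2 e : R, 0 < e & forall u : 'rV[int]_n, u != 0 -> e <= sqnorm (u^r *m N).
Proof.
case/row_freeP => D ND; pose t := \sum_i \sum_j `|D i j|.
have t0 : 0 <= t by apply: sumr_ge0 => i _; apply: sumr_ge0 => j _.
exists ((1 + t)^-1 ^+ 2) => [|u u0]; first by rewrite exprn_gt0 // invr_gt0; lra.
rewrite leNgt; apply/negP => h; case/negP: u0; apply/eqP/rowP => j.
set v := u^r *m N in h.
have vi i : `|v 0 i| <= (1 + t)^-1.
  rewrite -ler_sqr ?nnegrE ?normr_ge0 //; last by rewrite invr_ge0; lra.
  by rewrite real_normK ?num_real //; apply: le_trans (sqr_le_sqnorm v i) (ltW h).
have uj : `|(u 0 j)%:~R : R| < 1.
  have -> : (u 0 j)%:~R = (v *m D) 0 j by rewrite /v -mulmxA ND mulmx1 mxE.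
  rewrite mxE; apply: le_lt_trans (ler_norm_sum _ _ _) _.
  apply: (@le_lt_trans _ _ ((1 + t)^-1 * t)); last first.
    by rewrite mulrC ltr_pdivrMr; lra.
  rewrite mulr_sumr; apply: ler_sum => i _; rewrite normrM ler_pM //.
  by rewrite (bigD1 j) //= lerDl; apply: sumr_ge0 => l _.
move: uj; rewrite mxE -intr_norm -[1]/(1%:~R) ltr_int => uj.
by apply/eqP; rewrite -normr_le0 -ltzD1 add0r.
Qed.

(** By discreteness the infimum of the squared length of the first basis vector over all bases is
    positive, so some basis comes within a factor 2 of it. Any row of a basis can be swapped into
    the first place, whence the bound for all [k]. *)
Lemma near_min_basis (R : realType) (n m : nat) (N : 'M[R]_(n.+1, m)) : row_free N ->
  exists2 U : 'M[int]_n.+1, U \in unitmx &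
    0 < sqnorm (row 0 (U^r *m N)) /\
    forall V : 'M[int]_n.+1, V \in unitmx -> forall k,
      sqnorm (row 0 (U^r *m N)) <= 2 * sqnorm (row k (V^r *m N)).
Proof.
move=> Nf; have [e e0 eP] := lattice_sqnorm_bound Nf.
pose S : set R := fun z => exists2 U : 'M[int]_n.+1, U \in unitmx & z = sqnorm (row 0 (U^r *m N)).
have rowE (U : 'M[int]_n.+1) k : row k (U^r *m N) = (row k U)^r *m N.
  by rewrite row_mul; congr (_ *m _); apply/rowP => j; rewrite !mxE.
have eS z : S z -> e <= z.
  by case=> U Uu ->; rewrite rowE eP // unitmx_row_neq0.
have S0 : nonempty S by exists (sqnorm (row 0 ((1%:M : 'M[int]_n.+1)^r *m N))); exists 1%:M; rewrite ?unitmx1.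
have Si : has_inf S by split=> //; exists e => z /eS.
have i0 : 0 < inf S by apply: lt_le_trans e0 _; apply: lb_le_inf => // z /eS.
have [z [U Uu zE] zi] := inf_adherent i0 Si.
exists U => //; split; first by rewrite rowE (lt_le_trans e0) // eP // unitmx_row_neq0.
move=> V Vu k; rewrite -zE; apply: le_trans (ltW zi) _.
suff : inf S <= sqnorm (row k (V^r *m N)) by lra.
apply: ge_inf; first by exists e => ? /eS.
exists (xrow 0 k V); first by rewrite xrowE unitmx_mul unitmx_perm.
congr sqnorm; rewrite !rowE; congr (_ *m _); apply/rowP => j; by rewrite !mxE tpermL.
Qed.

(* LLL reduction without Gram-Schmidt vectors: the first vector is within a factor 2 of the
   shortest possible one, and the others are lifted from a reduced basis of the projection
   along it. *)
Lemma reduced_basis (R : realType) (n m : nat) (N : 'M[R]_(n, m)) : row_free N ->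
  exists2 U : 'M[int]_n, U \in unitmx &
    forall (c : 'rV[R]_n) (j k : 'I_n), (k <= j)%N -> (forall i : 'I_n, (j < i)%N -> c 0 i = 0) ->
      c 0 j ^+ 2 * sqnorm (row k (U^r *m N)) <= 4 ^+ j * sqnorm (c *m (U^r *m N)).
Proof.
elim: n N => [|n IH] N Nf.
  by exists 1%:M; rewrite ?unitmx1 // => c [].
have [U0 U0u [b0 bmin]] := near_min_basis Nf.
set b := row 0 (U0^r *m N) in b0 bmin.
pose N1 : 'M[R]_(1 + n, m) := U0^r *m N.
have rowN1 : row 0 N1 = b by [].
have uN1 : usubmx N1 = b.
  by apply/rowP => j; rewrite -rowN1 [LHS]mxE [RHS]mxE; congr (N1 _ _); apply: val_inj.
pose N2 := dsubmx N1; pose N' := N2 *m orth b.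
have U0r : (U0^r : 'M[R]_n.+1) \in unitmx.
  by rewrite unitmxE det_map_mx rmorph_unit // -unitmxE.
have N1f (v : 'rV[R]_(1 + n)) : v *m N1 = 0 -> v = 0.
  rewrite /N1 mulmxA => /eqP; rewrite mulmx_free_eq0 // => /eqP vU.
  by rewrite -[v](mulmxK U0r) vU mul0mx.
have N1E : N1 = col_mx b N2 by rewrite -uN1 vsubmxK.
(* A linear relation between the projected rows lifts to one between the rows of [N1], with
   coefficient [- s] at [b]. *)
have N'f : row_free N'.
  apply: inj_row_free => w; rewrite /N' mulmxA orthE; set s := _ / _ => wN.
  have : row_mx (- s)%:M w *m N1 = 0.
    by rewrite N1E mul_row_col mul_scalar_mx scaleNr addrC.
  by move/N1f/(congr1 rsubmx); rewrite row_mxKr linear0.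
have [U' U'u U'P] := IH _ N'f.
(* Size reduction: the nearest integer multiple of [b] is subtracted from each lifted row, leaving a
   coefficient of at most 1/2 in absolute value. *)
pose t k := dotp (row k (U'^r *m N2)) b / sqnorm b.
pose z : 'cV[int]_n := \col_k Num.floor (t k + 2^-1).
pose U1 : 'M[int]_(1 + n) := block_mx 1%:M 0 (- z) U' *m U0.
have U1u : U1 \in unitmx.
  by rewrite unitmx_mul U0u andbT unitmxE det_lblock det1 mul1r -unitmxE.
exists U1 => //; set W := U1^r *m N.
have WE : W = col_mx b (U'^r *m N2 - z^r *m b).
  rewrite /W /U1 map_mxM -mulmxA -/N1 (map_block_mx _ _ _ _ _) N1E mul_block_col.
  by rewrite map_mx1 map_mx0 map_mxN mul1mx mul0mx addr0 mulNmx addrC.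
have rW0 : row (lshift n 0) W = b by rewrite WE rowKu; apply/rowP => l; rewrite mxE; congr (b _ _); apply: val_inj.
pose v k := row (rshift 1 k) W.
have vE k : v k = row k (U'^r *m N2) - (z k 0)%:~R *: b.
  rewrite /v WE rowKd; apply/rowP => l; rewrite !mxE; congr (_ - _).
  by rewrite big_ord1 !mxE.
have v_orth k : v k *m orth b = row k (U'^r *m N').
  rewrite vE mulmxBl -scalemxAl orth_self // scaler0 subr0 -row_mul.
  by rewrite -mulmxA.
have tz k : (t k - (z k 0)%:~R) ^+ 2 <= 4^-1.
  rewrite mxE; have := floor_itv (t k + 2^-1).
  rewrite intrD => /andP[h1 h2].
  have -> : 4^-1 = (2^-1) ^+ 2 :> R by field.
  by rewrite -[X in X <= _]real_normK ?num_real // ler_sqr ?nnegrE ?invr_ge0 ?ler0n ?normr_ge0 // ler_norml; lra.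
(* If p is the projection of [v k], then |v|^2 <= |p|^2 + |b|^2/4 by size reduction and |b|^2 <=
   2|v|^2 by near-minimality; together they give both bounds. *)
have v_le k : sqnorm (v k) <= 2 * sqnorm (row k (U'^r *m N')) /\
              sqnorm b <= 4 * sqnorm (row k (U'^r *m N')).
  have := bmin _ U1u (rshift 1 k); rewrite -/b -/W -/(v k).
  have := sqnorm_decomp (v k) b0; rewrite v_orth.
  have -> : dotp (v k) b / sqnorm b = t k - (z k 0)%:~R.
    rewrite vE /t; set y := row k _; set s := (z k 0)%:~R.
    have -> : dotp (y - s *: b) b = dotp y b - s * sqnorm b.
      by rewrite /dotp /sqnorm mulr_sumr -sumrB; apply: eq_bigr => i _; rewrite !mxE; ring.
    by rewrite mulrBl mulfK ?gt_eqF.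
  have := tz k; set s := (_ ^+ 2) => s4.
  have : s * sqnorm b <= 4^-1 * sqnorm b by rewrite ler_wpM2r // ltW.
  by split; lra.
move=> c j k kj cj; set y := c *m W.
pose c' : 'rV[R]_n := rsubmx (c : 'rV[R]_(1 + n)).
have c'E i : c' 0 i = c 0 (rshift 1 i) by rewrite mxE.
have yE : y *m orth b = c' *m (U'^r *m N').
  have Wo : W *m orth b = col_mx 0 (U'^r *m N').
    rewrite WE (mul_col_mx b) orth_self // mulmxBl -[z^r *m b *m _]mulmxA orth_self //.
    by rewrite mulmx0 subr0 -mulmxA.
  by rewrite /y -mulmxA Wo (mul_row_col1 c) scaler0 add0r.
have yN : sqnorm (c' *m (U'^r *m N')) <= sqnorm y.
  by rewrite -yE (sqnorm_decomp y b0) lerDl mulr_ge0 ?sqr_ge0 // ltW.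
case: (@split_ordP 1 n j) kj cj => j' -> kj cj.
  have -> : k = lshift n 0 :> 'I_(1 + n).
    by apply: val_inj => /=; apply/eqP; rewrite -leqn0 (leq_trans kj) //= (ord1 j').
  rewrite (ord1 j') rW0 expr0 mul1r /y.
  have -> : c *m W = c 0 (lshift n (0 : 'I_1)) *: b.
    rewrite WE (mul_row_col1 c).
    have -> : rsubmx (c : 'rV[R]_(1 + n)) = 0.
      by apply/rowP => i; rewrite !mxE cj //= (ord1 j').
    by rewrite mul0mx addr0.
  rewrite /sqnorm mulr_sumr; apply: ler_sum => i _; by rewrite [X in _ <= X ^+ 2]mxE exprMn.
have cj' (i : 'I_n) : (j' < i)%N -> c' 0 i = 0 by move=> h; rewrite c'E cj //= ltn_add2l.
(* Projecting cannot lengthen [y], and each step of the induction costs the factor 4 from [v_le]. *)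
have main (k' : 'I_n) : (k' <= j')%N ->
    c' 0 j' ^+ 2 * (4 * sqnorm (row k' (U'^r *m N'))) <= 4 ^+ j'.+1 * sqnorm y.
  move=> kj'; have := U'P c' j' k' kj' cj'; rewrite [4 ^+ j'.+1]exprS => h.
  have : 4 ^+ j' * sqnorm (c' *m (U'^r *m N')) <= 4 ^+ j' * sqnorm y.
    by rewrite ler_wpM2l ?exprn_ge0.
  lra.
rewrite -c'E.
case: (@split_ordP 1 n k) kj => k' -> kj.
  rewrite (ord1 k') rW0; apply: le_trans (main j' (leqnn _)).
  by rewrite ler_wpM2l ?sqr_ge0 //; have [] := v_le j'.
apply: le_trans (main k' _); last by move: kj; rewrite /= leq_add2l.
rewrite ler_wpM2l ?sqr_ge0 // -/(v k'); have [h _] := v_le k'.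
have := sqnorm_ge0 (row k' (U'^r *m N')); lra.
Qed.

(** * Narrow cones around the all-ones vector, of index a power of 2 *)

(* With [lam] = 2^q / c_j, the point [p] is [lam] times the all-ones vector 1 with the coordinates
   other than the j-th rounded down, so that its j-th coordinate is 2^q. The rows [p] and
   [mu k * p + 2^s * b_k] (k <> j) span a sublattice of index a power of 2, and 1 lies in their cone:
   if [f k] denotes the rounding error, [lam * 1] is [p] plus the sum of the [f k * b_k], where the
   [f k * beta k] are small. *)
Section NarrowCone.

Variables (R : realType) (n m : nat) (b : 'M[R]_(n, m)) (c : 'rV[R]_n) (beta : 'I_n -> R).
Variables (j : 'I_n) (q s : nat) (T : R).
Hypothesis m_gt0 : (0 < m)%N.
Hypothesis c_ge0 : nneg c.
Hypothesis cb1 : c *m b = const_mx 1.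
Hypothesis b_le : forall k i, `|b k i| <= beta k.
Hypothesis cj_gt0 : 0 < c 0 j.
Hypothesis beta_small : forall k, k != j ->
  c 0 j * beta k * (16 * n%:R) <= 2 ^+ q \/ c 0 k * beta k * (16 * n%:R) <= 1.
Hypothesis s_large : 2 * n%:R <= 2 ^+ s :> R.
Hypothesis T_large : forall k, 5 * 2 ^+ s * beta k + 2 * (2 ^+ q / c 0 j) <= T.

Let lam := 2 ^+ q / c 0 j.
Let z k := lam * c 0 k.
Let f k := z k - (Num.floor (z k))%:~R.
Let pz : 'rV[int]_n := \row_k Num.floor (z k).
Let p := pz^r *m b.
(** The entries of [p] will be at least [lam / 2], so this multiple of [p] outweighs the negative
    entries of 2^s b_k; row [j] is [p] itself. *)
Let mu k := if k == j then 1%N else (Num.truncn (2 * 2 ^+ s * beta k / lam)).+1.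
Let G : 'M[int]_n := \matrix_(k, l)
  ((mu k)%:Z * pz 0 l + ((k != j) && (k == l))%:Z * 2 ^+ s).

Let n_gt0 : 0 < n%:R :> R.
Proof. by rewrite ltr0n (leq_ltn_trans _ (ltn_ord j)). Qed.

Let lam_gt0 : 0 < lam.
Proof. by rewrite divr_gt0 // exprn_gt0. Qed.

Let s_gt0 : 0 < 2 ^+ s :> R.
Proof. by rewrite exprn_gt0. Qed.

Let z_j : z j = 2 ^+ q.
Proof. by rewrite /z /lam divfK // gt_eqF. Qed.

Let f_itv k : 0 <= f k < 1.
Proof. by have := floor_itv (z k); rewrite intrD /f => /andP[h1 h2]; apply/andP; split; lra. Qed.

Let floor_zj : Num.floor (z j) = 2 ^+ q.
Proof. by rewrite z_j -natrX -[_%:R]/(2 ^ q)%N%:~R intrKfloor -natz natrX. Qed.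

Let f_j : f j = 0.
Proof. by rewrite /f floor_zj z_j rmorphXn /= subrr. Qed.

Let beta_ge0 k : 0 <= beta k.
Proof. by apply: le_trans (b_le k (Ordinal m_gt0)). Qed.

(** By [beta_small] either [beta k] is small compared to [lam] and [f k < 1] suffices, or [c 0 k] is
    small and [f k <= z k] is used. *)
Let f_beta k : f k * beta k * (16 * n%:R) <= lam.
Proof.
have bk := beta_ge0 k; have /andP[f0 f1] := f_itv k.
case: (eqVneq k j) => [->|kj]; first by rewrite f_j !mul0r ltW.
have n0 := n_gt0; case: (beta_small kj) => h.
  rewrite /lam ler_pdivlMr //; apply: le_trans h.
  have : 0 <= (1 - f k) * (beta k * n%:R * c 0 j).
    by rewrite !mulr_ge0 ?(ltW n_gt0) ?(ltW cj_gt0) // subr_ge0 ltW.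
  lra.
have fz : f k <= z k.
  by rewrite /f lerBlDr lerDl ler0z floor_ge0 mulr_ge0 ?(ltW lam_gt0).
have : f k * (beta k * n%:R) <= z k * (beta k * n%:R).
  by rewrite ler_wpM2r // mulr_ge0 // ltW.
have : lam * (c 0 k * beta k * (16 * n%:R)) <= lam * 1 by rewrite ler_wpM2l // ltW.
rewrite /z; lra.
Qed.

Let p_E i : p 0 i = lam - \sum_k f k * b k i.
Proof.
have /rowP/(_ i) := cb1; rewrite !mxE => e.
transitivity (lam * (\sum_k c 0 k * b k i) - \sum_k f k * b k i); last by rewrite e mulr1.
rewrite mulr_sumr -sumrB; apply: eq_bigr => k _.
by rewrite !mxE /f /z; ring.
Qed.

Let p_itv i : lam / 2 <= p 0 i <= 2 * lam.
Proof.
have : `|\sum_k f k * b k i| <= lam / 16.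
  apply: le_trans (ler_norm_sum _ _ _) _.
  apply: (@le_trans _ _ (\sum_(k < n) lam / (16 * n%:R))).
    apply: ler_sum => k _; have /andP[f0 _] := f_itv k.
    rewrite normrM ger0_norm // ler_pdivlMr ?mulr_gt0 //.
    by apply: le_trans (f_beta k); rewrite ler_wpM2r ?mulr_ge0 ?(ltW n_gt0) // ler_wpM2l.
  rewrite sumr_const card_ord -[X in X <= _]mulr_natl.
  by have -> : n%:R * (lam / (16 * n%:R)) = lam / 16 by field; rewrite gt_eqF.
rewrite ler_norml => /andP[h1 h2]; have := lam_gt0; rewrite p_E => h.
by apply/andP; split; lra.
Qed.

Let sbl_ge0 k : 0 <= 2 * 2 ^+ s * beta k / lam.
Proof. by rewrite divr_ge0 ?(ltW lam_gt0) // !mulr_ge0 // ltW. Qed.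

Let mu_itv k : k != j ->
  2 * 2 ^+ s * beta k / lam <= (mu k)%:R <= 2 * 2 ^+ s * beta k / lam + 1.
Proof.
move=> kj; rewrite /mu (negPf kj); set y := _ / lam.
by have /andP[h1 h2] := truncn_itv (sbl_ge0 k); rewrite ltW //= -natr1 lerD2r.
Qed.

Let GE k i : (G^r *m b) k i = (mu k)%:R * p 0 i + (k != j)%:R * (2 ^+ s * b k i).
Proof.
rewrite mxE /p mxE mulr_sumr.
transitivity (\sum_l (mu k)%:R * ((pz^r) 0 l * b l i) +
              \sum_l (k != j)%:R * ((k == l)%:R * (2 ^+ s * b l i))).
  rewrite -big_split; apply: eq_bigr => l _ /=; rewrite !mxE rmorphD !rmorphM /= rmorphXn /=.
  by rewrite -!pmulrn; case: (k != j); case: (k == l); rewrite /= ?mulr1n ?mulr0n; ring.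
congr (_ + _); rewrite -mulr_sumr; congr (_ * _); rewrite (bigD1 k) //= eqxx mul1r big1 ?addr0 //.
by move=> l lk; rewrite eq_sym (negPf lk) mul0r.
Qed.

(** [G] factors into a matrix adding multiples of row [j] to the other rows, a diagonal one with
    entries 1 and [2 ^+ s], and one whose only nontrivial row is [pz]. The last has determinant
    [pz 0 j], which was made equal to [2 ^+ q]. *)
Let det_G : \det G = 2 ^+ (q + s * n.-1).
Proof.
pose A : 'M[int]_n := (set_row j (\row_k (mu k)%:Z) 1%:M)^T.
pose D : 'M[int]_n := diag_mx (\row_k (if k == j then 1 else 2 ^+ s)).
have -> : G = A *m (D *m set_row j pz 1%:M).
  rewrite mul_diag_mx; apply/matrixP => k l; rewrite [RHS]mxE (bigD1 j) //= !mxE eqxx.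
  rewrite !mul1r; congr (_ + _).
  case: (eqVneq k j) => [->|kj] /=.
    by rewrite mul0r big1 // => i ij; rewrite !mxE (negPf ij) mul0r.
  rewrite (bigD1 k) //= [X in _ = _ + X]big1 ?addr0.
    by rewrite !mxE (negPf kj) eqxx mul1r; case: (k == l); rewrite ?mul1r ?mulr1 ?mul0r ?mulr0.
  by move=> i /andP[ij ik]; rewrite !mxE (negPf ij) (negPf ik) mul0r.
rewrite !det_mulmx det_tr !det_set_row1 det_diag !mxE /mu eqxx mul1r floor_zj.
rewrite (bigD1 j) //= mxE eqxx mul1r (eq_bigr (fun=> 2 ^+ s)) => [|k kj]; last first.
  by rewrite mxE (negPf kj).
by rewrite prodr_const cardC1 card_ord exprD exprM mulrC.
Qed.

Lemma narrow_cone_at : exists G : 'M[int]_n,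
  [/\ `|\det G| = 2 ^+ (q + s * n.-1), nneg (G^r *m b),
      forall k i, (G^r *m b) k i <= T & in_cone (G^r *m b) (const_mx 1)].
Proof.
exists G; split; first by rewrite det_G ger0_norm ?exprn_ge0.
- move=> k i; rewrite GE.
  have /andP[p1 p2] := p_itv i; have l0 := lam_gt0.
  case: (eqVneq k j) => [->|kj] /=; first by rewrite mul0r addr0 mulr_ge0 ?ler0n //; lra.
  have /andP[m1 _] := mu_itv kj; have := b_le k i; rewrite ler_norml => /andP[h _].
  have : 2 * 2 ^+ s * beta k / lam * (lam / 2) <= (mu k)%:R * p 0 i.
    by rewrite ler_pM // divr_ge0 // ltW.
  have -> : 2 * 2 ^+ s * beta k / lam * (lam / 2) = 2 ^+ s * beta k by field; rewrite gt_eqF.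
  have : 2 ^+ s * - beta k <= 2 ^+ s * b k i by rewrite ler_wpM2l // ltW.
  rewrite mul1r; lra.
- move=> k i; rewrite GE; apply: le_trans (T_large k); rewrite -/lam.
  have /andP[p1 p2] := p_itv i; have l0 := lam_gt0.
  have sb : 0 <= 2 ^+ s * beta k by rewrite mulr_ge0 // ltW.
  case: (eqVneq k j) => [kj|kj] /=.
    by rewrite mul0r addr0 /mu kj eqxx mul1r; rewrite -kj; lra.
  have /andP[_ m2] := mu_itv kj; have := b_le k i; rewrite ler_norml => /andP[_ h].
  have : (mu k)%:R * p 0 i <= (2 * 2 ^+ s * beta k / lam + 1) * (2 * lam).
    by rewrite ler_pM // ?ler0n //; lra.
  have -> : (2 * 2 ^+ s * beta k / lam + 1) * (2 * lam) = 4 * (2 ^+ s * beta k) + 2 * lam.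
    by field; rewrite gt_eqF.
  have : 2 ^+ s * b k i <= 2 ^+ s * beta k by rewrite ler_wpM2l // ltW.
  rewrite mul1r; lra.
(* Taking row [k] with coefficient [f k / (2 ^+ s * lam)] uses up [w / lam] of [p] in total; the
   remaining coefficient of [p] is nonnegative if [w <= 1], and each summand is at most 1/n. *)
pose w := \sum_(k | k != j) (mu k)%:R * f k / 2 ^+ s.
have w1 : w <= 1.
  apply: (@le_trans _ _ (\sum_(k < n) n%:R^-1)).
    rewrite [X in _ <= X](bigD1 j) //= ler_wpDl ?invr_ge0 ?ler0n //.
    apply: ler_sum => k kj; have /andP[_ m2] := mu_itv kj; have /andP[f0 f1] := f_itv k.
    rewrite ler_pdivrMr // [X in _ <= X]mulrC ler_pdivlMr //.
    have l0 := lam_gt0; have n0 := n_gt0.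
    have : (mu k)%:R * f k * n%:R <= (2 * 2 ^+ s * beta k / lam + 1) * f k * n%:R.
      by rewrite !ler_wpM2r // ltW.
    have -> : (2 * 2 ^+ s * beta k / lam + 1) * f k * n%:R =
              2 ^+ s / 8 * (f k * beta k * (16 * n%:R) / lam) + f k * n%:R.
      by field; rewrite gt_eqF.
    have : f k * beta k * (16 * n%:R) / lam <= 1 by rewrite ler_pdivrMr // mul1r.
    move=> h; have : 2 ^+ s / 8 * (f k * beta k * (16 * n%:R) / lam) <= 2 ^+ s / 8 * 1.
      by rewrite ler_wpM2l // divr_ge0 // ltW.
    have : f k * n%:R <= 1 * n%:R by rewrite ler_wpM2r ?ltW.
    have := s_large; have := s_gt0; lra.
  by rewrite sumr_const card_ord -[X in X <= _]mulr_natl divff ?gt_eqF.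
exists (\row_k (if k == j then (1 - w) / lam else f k / (2 ^+ s * lam))).
  move=> i k; rewrite mxE; case: eqP => _; first by rewrite divr_ge0 ?subr_ge0 ?(ltW lam_gt0).
  have /andP[f0 _] := f_itv k.
  by rewrite divr_ge0 // mulr_ge0 ?(ltW lam_gt0) ?(ltW s_gt0).
apply/rowP => i; rewrite !mxE.
under eq_bigr do rewrite mxE GE.
rewrite (bigD1 j) //= eqxx /= mul0r addr0 {1}/mu eqxx mul1r.
have -> : \sum_(k | k != j) (if k == j then (1 - w) / lam else f k / (2 ^+ s * lam)) *
    ((mu k)%:R * p 0 i + (k != j)%:R * (2 ^+ s * b k i)) =
    w / lam * p 0 i + (\sum_k f k * b k i) / lam.
  rewrite [X in _ + X / _](bigD1 j) //= f_j mul0r add0r !mulr_suml -big_split /=.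
  apply: eq_bigr => k kj; rewrite (negPf kj) /=; field.
  by rewrite !gt_eqF.
have -> : \sum_k f k * b k i = lam - p 0 i by rewrite p_E; ring.
by field; rewrite gt_eqF.
Qed.

End NarrowCone.

(** In a reduced basis, let [j] be the last index at which the all-ones vector has a non-negligible
    coefficient. Later coefficients are small, and reducedness bounds [c 0 j * beta k] for k <= j;
    these are the two alternatives of [beta_small]. *)
Lemma narrow_cone (R : realType) (n d L : nat) (N : 'M[R]_n) (rho : R) :
  (0 < n)%N -> (n <= d)%N -> (d <= 2 ^ L)%N -> N \in unitmx -> 0 < rho ->
  (forall i j, `|N i j| <= rho) ->
  exists G : 'M[int]_n,
  [/\ `|\det G| = 2 ^+ (d + 5 + 2 * L + L.+1 * n.-1), nneg (G^r *m N),
      forall i j, (G^r *m N) i j <= 2 ^+ (2 * d + 11 + 4 * L) * rho &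
      in_cone (G^r *m N) (const_mx 1)].
Proof.
move=> n0 nd dL Nu rho0 N_le.
have n1 : 1 <= n%:R :> R by rewrite ler1n.
have nL : n%:R <= 2 ^+ L :> R by rewrite -natrX ler_nat (leq_trans nd).
have Nf : row_free N by rewrite row_free_unit.
have [U Uu Ured] := reduced_basis Nf.
have Ur : (U^r : 'M[R]_n) \in unitmx by rewrite unitmxE det_map_mx rmorph_unit // -unitmxE.
(* Basis vectors are negated where necessary to make the coefficients of the all-ones vector
   nonnegative. *)
pose c0 : 'rV[R]_n := const_mx 1 *m invmx (U^r *m N).
pose sg i : bool := c0 0 i < 0.
pose E : 'M[int]_n := diag_mx (\row_i (-1) ^+ sg i).
pose V := E *m U.
have Vu : V \in unitmx.
  have EE : E *m E = 1%:M.
    rewrite mul_diag_mx; apply/matrixP => i j; rewrite !mxE.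
    by case: (eqVneq i j) => [->|]; rewrite ?mulr0 // mulr1n -expr2 sqrr_sign.
  by rewrite unitmx_mul Uu andbT; case: (mulmx1_unit EE).
pose b := V^r *m N.
have bE k i : b k i = (-1) ^+ sg k * (U^r *m N) k i.
  by rewrite /b /V map_mxM -mulmxA map_diag_mx mul_diag_mx mxE !mxE rmorphXn /= rmorphN1.
pose c : 'rV[R]_n := \row_i `|c0 0 i|.
have cE i : c 0 i = (-1) ^+ sg i * c0 0 i by rewrite mxE /sg normrEsign.
have sumE (x y : 'rV[R]_n) (H : forall i, x 0 i = (-1) ^+ sg i * y 0 i) : x *m b = y *m (U^r *m N).
  apply/rowP => i; rewrite mxE [RHS]mxE; apply: eq_bigr => k _.
  by rewrite H bE mulrACA -expr2 sqrr_sign mul1r.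
have cb1 : c *m b = const_mx 1.
  by rewrite (sumE c c0 cE) /c0 mulmxKV // unitmx_mul Ur Nu.
pose beta k := Num.sqrt (sqnorm (row k (U^r *m N))).
have beta2 k : beta k ^+ 2 = sqnorm (row k (U^r *m N)) by rewrite sqr_sqrtr // sqnorm_ge0.
have beta_ge0 k : 0 <= beta k by exact: sqrtr_ge0.
have b_le k i : `|b k i| <= beta k.
  rewrite bE normrM normr_sign mul1r -ler_sqr ?nnegrE // real_normK ?num_real // beta2.
  by have := sqr_le_sqnorm (row k (U^r *m N)) i; rewrite mxE.
have red (y : 'rV[R]_n) (j k : 'I_n) : (k <= j)%N -> (forall i : 'I_n, (j < i)%N -> y 0 i = 0) ->
    y 0 j ^+ 2 * beta k ^+ 2 <= 4 ^+ n * sqnorm (y *m b).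
  move=> kj yj; pose y' : 'rV[R]_n := \row_i ((-1) ^+ sg i * y 0 i).
  have H i : y 0 i = (-1) ^+ sg i * y' 0 i by rewrite mxE mulrA -expr2 sqrr_sign mul1r.
  rewrite (sumE y y' H) beta2 H exprMn sqrr_sign mul1r.
  apply: le_trans (Ured y' j k kj _) _ => [i ji|]; first by rewrite mxE yj ?mulr0.
  by rewrite ler_wpM2r ?sqnorm_ge0 // ler_weXn2l ?ler1n // ltnW.
have four (k : nat) : 4 ^+ k = (2 ^+ k) ^+ 2 :> R by rewrite exprAC; congr (_ ^+ _); rewrite -natrX.
pose rho1 := 2 ^+ n * n%:R * rho.
have rho1_gt0 : 0 < rho1 by rewrite !mulr_gt0 ?exprn_gt0 // ltr0n.
(* Some row of [N] has a nonzero integral coefficient at the last basis vector; reducedness at that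
   index bounds all basis vectors in terms of this row. *)
have beta_le k : beta k <= rho1.
  have [l nl] : exists l : 'I_n, n = l.+1 by exists (Ordinal (eq_leq (prednK n0))); rewrite /= prednK.
  have Viu : invmx V \in unitmx by rewrite unitmx_inv.
  have [i yl] : exists i, invmx V i l != 0.
    by have := @unitmx_row_neq0 n (invmx V)^T l; rewrite unitmx_tr Viu => /(_ isT)/rV0Pn[i]; rewrite !mxE; exists i.
  pose y := row i ((invmx V)^r : 'M[R]_n).
  have yN : y *m b = row i N.
    by rewrite /y -row_mul /b mulmxA -map_mxM (mulVmx Vu) map_mx1 mul1mx.
  have kl : (k <= l)%N by have := ltn_ord k; lia.
  have h := red y l k kl; rewrite yN in h.
  rewrite -ler_sqr ?nnegrE ?(ltW rho1_gt0) //.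
  apply: (@le_trans _ _ (y 0 l ^+ 2 * beta k ^+ 2)).
    rewrite ler_peMl ?sqr_ge0 // !mxE -rmorphXn /= ler1z.
    have : 0 < invmx V i l ^+ 2 by rewrite lt0r sqr_ge0 sqrf_eq0 yl.
    by [].
  apply: le_trans (h _) _ => [m lm|]; first by have := ltn_ord m; lia.
  rewrite four /rho1 !exprMn -mulrA ler_wpM2l ?sqr_ge0 //.
  apply: (@le_trans _ _ (\sum_(i < n) rho ^+ 2)).
    apply: ler_sum => m _; rewrite mxE -[X in X <= _]real_normK ?num_real //.
    by rewrite ler_sqr ?nnegrE // ltW.
  rewrite sumr_const card_ord -[X in X <= _]mulr_natl ler_wpM2r ?sqr_ge0 //.
  by rewrite expr2 ler_peMl ?ler0n.
have nd2 : 2 ^+ n <= 2 ^+ d :> R by rewrite ler_weXn2l ?ler1n.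
have rho1_le : rho1 <= 2 ^+ (d + L) * rho.
  by rewrite exprD ler_wpM2r ?(ltW rho0) // ler_pM ?exprn_ge0 // ler0n.
clearbody rho1.
have c_ge0 : nneg c by move=> i k; rewrite mxE normr_ge0.
(* Coefficients below [1 / T0] together contribute at most 1/16 to every coordinate, so they cannot
   make up the all-ones vector by themselves. *)
pose T0 := 16 * n%:R * rho1.
have n_gt0 : 0 < n%:R :> R by rewrite ltr0n.
have T0_gt0 : 0 < T0 by apply: mulr_gt0 => //; apply: mulr_gt0.
have tail (K : pred 'I_n) i : (forall k, K k -> c 0 k * T0 < 1) ->
    `|\sum_(k | K k) c 0 k * b k i| <= 16^-1.
  move=> Kc; apply: le_trans (ler_norm_sum _ _ _) _.
  apply: (@le_trans _ _ (\sum_(k < n) (16 * n%:R)^-1)).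
    rewrite [X in _ <= X](bigID K) /= ler_wpDr ?sumr_ge0 // => [k _|].
      by rewrite invr_ge0 mulr_ge0 // ltW.
    apply: ler_sum => k /Kc ck; rewrite normrM ger0_norm ?c_ge0 //.
    rewrite -[X in _ <= X]mul1r ler_pdivlMr ?mulr_gt0 //; apply: le_trans (ltW ck).
    have -> : c 0 k * `|b k i| * (16 * n%:R) = c 0 k * (16 * n%:R * `|b k i|) by ring.
    rewrite ler_wpM2l ?c_ge0 // ler_wpM2l ?mulr_ge0 ?(ltW n_gt0) //.
    exact: le_trans (b_le k i) (beta_le k).
  rewrite sumr_const card_ord -[X in X <= _]mulr_natl.
  by have -> : n%:R * (16 * n%:R)^-1 = 16^-1 :> R by field; rewrite gt_eqF.
have cbi i : \sum_k c 0 k * b k i = 1 by have /rowP/(_ i) := cb1; rewrite !mxE.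
have [j cj jmax] : exists2 j : 'I_n, 1 <= c 0 j * T0 &
    forall k : 'I_n, (j < k)%N -> c 0 k * T0 < 1.
  have [k0 /= Pk0|P0] := pickP [pred k | 1 <= c 0 k * T0].
    case: (@arg_maxnP _ k0 [pred k | 1 <= c 0 k * T0] (@nat_of_ord n) Pk0) => j /= Pj jmax.
    by exists j => // k jk; rewrite ltNge; apply/negP => /jmax; rewrite leqNgt jk.
  have := @tail predT (Ordinal n0); rewrite cbi normr1.
  have : (forall k, predT k -> c 0 k * T0 < 1).
    by move=> k _; rewrite ltNge; have /= -> := P0 k.
  by move=> h /(_ h); lra.
have cj0 : 0 < c 0 j by rewrite -(pmulr_lgt0 _ T0_gt0); lra.
(* Cutting [c] off after [j] changes the all-ones vector by at most 1/16 in each coordinate, so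
   reducedness is applied to a vector of squared length at most 4n. *)
pose y : 'rV[R]_n := \row_k (if (k <= j)%N then c 0 k else 0).
have yE k : y 0 k = if (k <= j)%N then c 0 k else 0 by rewrite mxE.
have yN : sqnorm (y *m b) <= 4 * n%:R.
  apply: (@le_trans _ _ (\sum_(i < n) 4)); last by rewrite sumr_const card_ord mulr_natr.
  apply: ler_sum => i _.
  have : (y *m b) 0 i = 1 - \sum_(k : 'I_n | (j < k)%N) c 0 k * b k i.
    apply/eqP; rewrite eq_sym subr_eq -(cbi i) (bigID (fun k : 'I_n => (k <= j)%N)) /=; apply/eqP.
    congr (_ + _); last by apply: eq_bigl => k; rewrite ltnNge.
    rewrite [RHS]mxE [RHS](bigID (fun k : 'I_n => (k <= j)%N)) /= [X in _ = _ + X]big1 ?addr0.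
      by apply: eq_bigr => k kj; rewrite yE kj.
    by move=> k kj; rewrite yE (negPf kj) mul0r.
  have := tail (fun k : 'I_n => (j < k)%N) i jmax; rewrite ler_norml => /andP[t1 t2] ->.
  have -> : 4 = 2 ^+ 2 :> R by rewrite -natrX.
  by rewrite ler_sqr ?nnegrE; lra.
have cbeta (k : 'I_n) : (k <= j)%N -> c 0 j * beta k <= 2 ^+ n * (2 * n%:R).
  move=> kj; rewrite -ler_sqr ?nnegrE ?mulr_ge0 ?c_ge0 ?exprn_ge0 ?(ltW n_gt0) // exprMn.
  have yj : y 0 j = c 0 j by rewrite yE leqnn.
  have := red y j k kj; rewrite yj => h; apply: le_trans (h _) _ => [i ji|].
    by rewrite yE leqNgt ji.
  rewrite exprMn -four ler_wpM2l ?exprn_ge0 //; apply: le_trans yN _.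
  by rewrite exprMn -natrX ler_wpM2l ?ler0n // expr2 ler_peMl // ltW.
(* [2 ^+ q] has to reach (2^n * 2n) * 16n = 32 * 2^n * n^2, where n <= d and n <= 2^L. *)
have [q qE] : exists q, (q = d + 5 + 2 * L)%N by eexists.
have small k : k != j ->
    c 0 j * beta k * (16 * n%:R) <= 2 ^+ q \/ c 0 k * beta k * (16 * n%:R) <= 1.
  move=> kj; case: (ltnP j k) => jk.
    right; apply: le_trans (ltW (jmax k jk)); rewrite -mulrA ler_wpM2l ?c_ge0 //.
    by rewrite /T0 mulrC ler_wpM2l // mulr_ge0 // ltW.
  left; apply: (@le_trans _ _ (2 ^+ n * (2 * n%:R) * (16 * n%:R))).
    by rewrite ler_wpM2r ?cbeta // mulr_ge0 // ltW.
  have -> : 2 ^+ n * (2 * n%:R) * (16 * n%:R) = 2 ^+ 5 * (2 ^+ n * (n%:R * n%:R)) :> R.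
    have e32 : 2 ^+ 5 = 32 :> R by rewrite -natrX.
    by rewrite e32; ring.
  have -> : 2 ^+ q = 2 ^+ 5 * (2 ^+ d * (2 ^+ L * 2 ^+ L)) :> R.
    by rewrite qE mul2n -addnn !exprD; ring.
  by rewrite ler_wpM2l ?exprn_ge0 // ler_pM ?exprn_ge0 ?mulr_ge0 ?(ltW n_gt0) // ler_pM // ltW.
have s_large : 2 * n%:R <= 2 ^+ L.+1 :> R by rewrite exprS ler_wpM2l.
have T_large k : 5 * 2 ^+ L.+1 * beta k + 2 * (2 ^+ q / c 0 j) <= 2 ^+ (2 * d + 11 + 4 * L) * rho.
  have h1 : 5 * 2 ^+ L.+1 * beta k <= 10 * 2 ^+ L * rho1.
    by rewrite exprS mulrA ler_pM ?mulr_ge0 ?exprn_ge0 //; lra.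
  have h2 : 2 ^+ q / c 0 j <= 2 ^+ (d + 9 + 3 * L) * rho1.
    rewrite ler_pdivrMr //.
    have -> : 2 ^+ (d + 9 + 3 * L) * rho1 * c 0 j = 2 ^+ q * (2 ^+ L * (2 ^+ 4 * rho1 * c 0 j)).
      have -> : (d + 9 + 3 * L = q + (L + 4))%N by move: qE; clear; lia.
      by rewrite !exprD; ring.
    rewrite -[X in X <= _]mulr1 ler_wpM2l ?exprn_ge0 //.
    have e16 : 2 ^+ 4 = 16 :> R by rewrite -natrX.
    apply: le_trans cj _; rewrite /T0 e16.
    have -> : c 0 j * (16 * n%:R * rho1) = n%:R * (16 * rho1 * c 0 j) by ring.
    by rewrite ler_wpM2r // !mulr_ge0 // ltW.
  have h3 : 10 * 2 ^+ L <= 2 ^+ (d + 10 + 3 * L) :> R.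
    rewrite -!natrX -natrM ler_nat.
    apply: (@leq_trans (2 ^ 4 * 2 ^ L)); first by apply: leq_mul.
    by rewrite -expnD leq_exp2l //; clear; lia.
  apply: le_trans (lerD h1 (ler_wpM2l (ler0n _ 2) h2)) _.
  have -> : 10 * 2 ^+ L * rho1 + 2 * (2 ^+ (d + 9 + 3 * L) * rho1) =
            (10 * 2 ^+ L + 2 ^+ (d + 10 + 3 * L)) * rho1.
    have -> : (d + 10 + 3 * L = (d + 9 + 3 * L).+1)%N by clear; lia.
    by rewrite [2 ^+ _.+1]exprS; ring.
  apply: (@le_trans _ _ (2 * 2 ^+ (d + 10 + 3 * L) * (2 ^+ (d + L) * rho))).
    by rewrite ler_pM ?addr_ge0 ?mulr_ge0 ?exprn_ge0 ?(ltW rho1_gt0) //; lra.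
  rewrite mulrA ler_wpM2r ?(ltW rho0) // -exprS -exprD ler_weXn2l ?ler1n //; clear; lia.
have [G [detG G0 GT Gx]] := narrow_cone_at n0 c_ge0 cb1 b_le cj0 small s_large T_large.
exists (G *m V); rewrite -qE; rewrite map_mxM -mulmxA -/b; split=> //.
by rewrite det_mulmx normrM detG; move: Vu; rewrite unitmxE => /orP[]/eqP->; rewrite ?normrN1 ?normr1 mulr1.
Qed.

(** * Unimodular cones in the orthant, by induction on the dimension *)

Lemma sort_perm (R : realType) (n : nat) (f : 'I_n -> R) :
  exists s : 'S_n, forall i j : 'I_n, (i <= j)%N -> f (s j) <= f (s i).
Proof.
pose e (i j : 'I_n) := f j <= f i.
have e_tr : transitive e by move=> y x z xy yz; exact: le_trans yz xy.
have e_refl : reflexive e by move=> x; exact: lexx.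
have e_tot : total e by move=> x y; exact: le_total.
have : perm_eq (sort e (ord_tuple n)) (ord_tuple n) by rewrite perm_sort.
case/(@tuple_permP _ _ _ (ord_tuple n)) => s sE; exists s => i j ij.
have ss : sorted e (sort e (ord_tuple n)) by exact: sort_sorted.
have sz : size (sort e (ord_tuple n)) = n by rewrite size_sort size_tuple.
have nthE (k : 'I_n) : nth i (sort e (ord_tuple n)) k = s k.
  by rewrite sE -tnth_nth tnth_mktuple tnth_ord_tuple.
have := sorted_leq_nth e_tr e_refl i ss; move=> /(_ i j); rewrite !inE !sz !ltn_ord !nthE.
by move=> /(_ isT isT ij).
Qed.

(** The Smith normal form of a single row; a negative sign is moved into [W]. *)
Lemma primitive_row (n : nat) (z : 'rV[int]_n.+1) : z != 0 ->
  exists W : 'M[int]_n.+1, exists2 g : int, 0 < g & W \in unitmx /\ z = g *: row 0 W.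
Proof.
move=> z0; have [A Au [W Wu [d _ zE]]] := int_Smith_normal_form z.
have zW : z = (A 0 0 * d`_0) *: row 0 W.
  rewrite zE {1}(mx11_scalar A) mul_scalar_mx -scalemxAl -scalerA; congr (_ *: _).
  apply/rowP => j; rewrite !mxE (bigD1 0) //= !mxE eqxx big1 ?addr0 //.
  by case=> -[|i] //= ? _; rewrite !mxE mulr0n mul0r.
set g := _ * _ in zW.
have g0 : g != 0 by apply: contraNneq z0 => g0; rewrite zW g0 scale0r.
case: (ltrP 0 g) => [gp|gn]; first by exists W, g.
exists (- W); exists (- g); first by rewrite oppr_gt0 lt_neqAle g0.
split; last by rewrite linearN scalerN scaleNr opprK.
by rewrite -scaleN1r unitmxZ.
Qed.

Lemma extend_cone (R : realType) (p q m : nat) (E : 'M[R]_(p + q, m)) (U : 'M[int]_p)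
    (y z : 'rV[R]_m) :
  in_cone (U^r *m usubmx E) y -> in_cone (dsubmx E) z ->
  in_cone ((block_mx U 0 0 1%:M : 'M[int]_(p + q))^r *m E) (y + z).
Proof.
move=> [a a0 ->] [c c0 ->]; exists (row_mx a c).
  by move=> i j; rewrite mxE; case: split => k; rewrite ?a0 ?c0.
rewrite map_block_mx !map_mx0 map_mx1 -{3}[E]vsubmxK mul_block_col !mul0mx mul1mx addr0 add0r.
by rewrite mul_row_col.
Qed.

(* The generators have entries at most D^r * (2^(2D+11+4L) * 2D), where the first factor is lost in
   the [r] steps of [halving] and the second one comes from [narrow_cone]. *)
Definition cone_exp (D L : nat) : nat := L * (D + 5 + 2 * L + L.+1 * D) + (2 * D + 11 + 4 * L) + L.+1.

(* The coordinates relative to [N] are scaled so that the given point becomes the all-ones vector. *)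
Lemma corner (R : realType) (n d D L : nat) (g : R) (t : 'cV[R]_n) (u : 'M[R]_(n, d))
    (beta : R) (a : 'rV[R]_n) :
  (1 + n <= D)%N -> (D <= 2 ^ L)%N -> 1 <= g -> (forall i, 0 <= t i 0 <= 1) -> nneg u ->
  (forall i, (2 * D%:R)^-1 <= a 0 i) -> 2^-1 <= beta / g + (a *m t) 0 0 <= 1 ->
  (forall i, (a *m u) 0 i <= 1) ->
  let E := block_mx g^-1%:M 0 t u : 'M[R]_(1 + n, 1 + d) in
  exists U : 'M[int]_(1 + n), [/\ U \in unitmx, nneg (U^r *m E),
    forall i j, (U^r *m E) i j <= 2 ^+ cone_exp D L &
    in_cone (U^r *m E) (row_mx beta%:M a *m E)].
Proof.
move=> nD DL g1 t01 u0 a_ge; set y0 := _ + _ => /andP[y0_ge y0_le] au1 E.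
have D0 : 0 < D%:R :> R by rewrite ltr0n (leq_trans _ nD).
have D1 : 1 <= D%:R :> R by rewrite ler1n (leq_trans _ nD).
have y0_gt0 : 0 < y0 by apply: lt_le_trans y0_ge; rewrite invr_gt0.
have a_gt0 i : 0 < a 0 i by apply: lt_le_trans (a_ge i); rewrite invr_gt0 mulr_gt0.
(* The scaling is the factorization [N *m F = E], where [const_mx 1 *m F] is the given point. The
   lower bounds 1/2 for [y0] and 1/(2D) for the [a 0 i] keep the entries of [N] at most 2D. *)
pose N : 'M[R]_(1 + n) := block_mx (g * y0)^-1%:M 0 (y0^-1 *: t) (diag_mx (\row_i (a 0 i)^-1)).
have Nu : N \in unitmx.
  rewrite unitmxE det_lblock det_scalar1 det_diag unitfE mulf_neq0 //.
    by rewrite invr_neq0 // mulf_neq0 // gt_eqF //; apply: lt_le_trans g1.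
  by apply/prodf_neq0 => i _; rewrite mxE invr_neq0 // gt_eqF.
have N_le i j : `|N i j| <= 2 * D%:R.
  rewrite /N; case: (split_ordP i) => i' ->; case: (split_ordP j) => j' ->.
  - rewrite block_mxEul mxE (ord1 i') (ord1 j') eqxx mulr1n invfM normrM !normfV.
    rewrite !ger0_norm ?(ltW y0_gt0) //; last by lra.
    rewrite -[X in _ <= X]mulr1 mulrC ler_pM ?invr_ge0 ?(ltW y0_gt0) //; try lra.
      by rewrite invf_ple ?posrE //; first (apply: le_trans y0_ge; rewrite lef_pV2 ?posrE ?mulr_gt0 //; lra); rewrite mulr_gt0.
    by rewrite invf_le1 //; lra.
  - by rewrite block_mxEur mxE normr0 mulr_ge0 // ltW.
  - rewrite block_mxEdl (ord1 j') mxE normrM normfV !ger0_norm ?(ltW y0_gt0) //; last by case/andP: (t01 i').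
    have /andP[t0 t1] := t01 i'.
    rewrite mulrC ler_pdivrMr //; apply: le_trans t1 _.
    have : 2 * D%:R * 2^-1 <= 2 * D%:R * y0 by rewrite ler_wpM2l // mulr_ge0 // ltW.
    lra.
  - rewrite block_mxEdr !mxE; case: eqP => _; last by rewrite mulr0n normr0 mulr_ge0 // ltW.
    by rewrite mulr1n normfV ger0_norm ?(ltW (a_gt0 _)) // invf_ple ?posrE ?mulr_gt0.
have [G [detG G0 GT Gx]] := narrow_cone (ltn0Sn n) nD DL Nu (mulr_gt0 (ltr0n _ 2) D0) N_le.
have [U [Uu U0 UT [c c0 Ux]]] := halving detG G0 GT Gx.
pose F : 'M[R]_(1 + n, 1 + d) := block_mx y0%:M 0 0 (diag_mx a *m u).
have NF : N *m F = E.
  rewrite mulmx_block !mul0mx !mulmx0 !addr0 add0r -scalar_mxM.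
  rewrite -scalemxAl mul_mx_scalar scalerA mulVf ?gt_eqF // scale1r mulmxA.
  have -> : (g * y0)^-1 * y0 = g^-1 by field; rewrite !gt_eqF //; lra.
  have -> : diag_mx (\row_i (a 0 i)^-1) *m diag_mx a = 1%:M.
    rewrite mul_diag_mx; apply/matrixP => i j; rewrite !mxE.
    by case: (eqVneq i j) => [->|]; rewrite ?mulr0 // !mulr1n mulVf // gt_eqF.
  by rewrite mul1mx.
have F0 : nneg F.
  move=> i j; rewrite /F; case: (split_ordP i) => i' ->; case: (split_ordP j) => j' ->.
  - by rewrite block_mxEul mxE; case: eqP; rewrite ?mulr1n // ltW.
  - by rewrite block_mxEur mxE.
  - by rewrite block_mxEdl mxE.
  - by rewrite block_mxEdr mul_diag_mx mxE mulr_ge0 ?u0 // ltW.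
have F1 : const_mx 1 *m F = row_mx beta%:M a *m E.
  rewrite -[const_mx 1]row_mx_const mul_row_block mul_row_block !mulmx0 !addr0 !add0r.
  congr row_mx; last first.
    rewrite mulmxA; congr (_ *m _); apply/rowP => i.
    by rewrite mul_mx_diag !mxE mul1r.
  apply/rowP => i; rewrite !ord1 mul_mx_scalar -scalar_mxM !mxE.
  by rewrite mulr1 /y0 mxE mulr1n.
exists U; split=> //.
- move=> i j; rewrite -NF mulmxA mxE; apply: sumr_ge0 => k _; by rewrite mulr_ge0 ?U0 ?F0.
- move=> i j; rewrite -NF mulmxA mxE; set TT := _ * _ in UT.
  have TT0 : 0 <= TT by apply: le_trans (U0 i i) (UT i i).
  (* The column sums of [F] are the coordinates of the given point, hence at most 1. So the bound
     does not depend on the size of the entries of [u], and it does not grow along the induction on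
     the dimension. *)
  apply: (@le_trans _ _ (TT * \sum_k F k j)).
    by rewrite mulr_sumr; apply: ler_sum => k _; rewrite ler_wpM2r ?F0.
  apply: (@le_trans _ _ (TT * 1)).
    rewrite ler_wpM2l //.
    have -> : \sum_k F k j = ((const_mx 1 : 'rV[R]_(1 + n)) *m F) 0 j.
      by rewrite mxE; apply: eq_bigr => k _; rewrite [const_mx _ _ _]mxE mul1r.
    rewrite F1 mul_row_block; case: (split_ordP j) => j' ->.
      by rewrite row_mxEl (ord1 j') mul_scalar_mx scale_scalar_mx !mxE mulr1n; move: y0_le; rewrite /y0 !mxE.
    by rewrite row_mxEr mulmx0 add0r au1.
  rewrite mulr1 /TT.
  have DL' : D%:R <= 2 ^+ L :> R by rewrite -natrX ler_nat.
  have nL' : n.+1%:R <= 2 ^+ L :> R by apply: le_trans DL'; rewrite ler_nat.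
  set r := (_ + _ * n.+1.-1)%N.
  have r_le : (r <= D + 5 + 2 * L + L.+1 * D)%N by rewrite /r leq_add2l leq_mul2l (leq_trans _ nD) ?orbT.
  apply: (@le_trans _ _ ((2 ^+ L) ^+ r * (2 ^+ (2 * D + 11 + 4 * L) * (2 * 2 ^+ L)))).
    rewrite ler_pM ?exprn_ge0 ?mulr_ge0 ?exprn_ge0 ?(ltW D0) //.
      by rewrite lerXn2r ?nnegrE ?ler0n ?exprn_ge0.
    by rewrite ler_wpM2l ?exprn_ge0 // ler_wpM2l.
  rewrite -exprM -exprS -!exprD ler_weXn2l ?ler1n // /cone_exp addnA !leq_add2r.
  by rewrite leq_mul2l r_le orbT.
- by exists c => //; rewrite -F1 Ux -NF !mulmxA.
Qed.

(** The rows of [B] stand for a lattice basis; those of [U^r *m B] are then another basis, so their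
    cone is unimodular for that lattice. *)
Definition has_cone (R : realType) (d : nat) (T : R) (B : 'M[R]_d) (x : 'rV[R]_d) : Prop :=
  exists U : 'M[int]_d, [/\ U \in unitmx, nneg (U^r *m B),
    forall i j, (U^r *m B) i j <= T & in_cone (U^r *m B) x].

(* The rows of [u] with a small coefficient [a 0 i] stay in the basis; the remaining coefficients
   are large enough for [corner]. *)
Lemma cone_split (R : realType) (n m D L : nat) (g beta : R) (t : 'cV[R]_(n + m))
    (u : 'M[R]_(n + m)) (a : 'rV[R]_(n + m)) (M : 'M[int]_(1 + (n + m)))
    (B : 'M[R]_(1 + (n + m))) :
  (1 + (n + m) <= D)%N -> (D <= 2 ^ L)%N -> 1 <= g -> (forall i, 0 <= t i 0 <= 1) -> nneg u ->
  (forall i j, u i j <= 2 ^+ cone_exp D L) -> nneg a ->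
  (forall i : 'I_(n + m), (i < n)%N = ((2 * D%:R)^-1 <= a 0 i)) ->
  beta / g + (a *m t) 0 0 = 1 -> (forall i, (a *m u) 0 i <= 1) ->
  M \in unitmx -> M^r *m B = block_mx g^-1%:M 0 t u ->
  has_cone (2 ^+ cone_exp D L) B (row_mx beta%:M a *m (M^r *m B)).
Proof.
move=> nmD DL g1 t01 u0 uT a0 an y01 au1 Mu ME.
set T := 2 ^+ _ in uT *.
have D0 : 0 < D%:R :> R by rewrite ltr0n (leq_trans _ nmD).
have T1 : 1 <= T by rewrite exprn_ege1 // ler1n.
pose tA := usubmx t; pose tB := dsubmx t; pose uA := usubmx u; pose uB := dsubmx u.
pose aA := lsubmx a; pose aB := rsubmx a.
pose E : 'M[R]_(1 + n + m, 1 + (n + m)) := M^r *m B.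
have EE (i : 'I_(1 + (n + m))) j : E i j = block_mx g^-1%:M 0 t u i j by rewrite -ME.
have EA : usubmx E = block_mx g^-1%:M 0 tA uA.
  apply/matrixP => i j; rewrite mxE.
  case: (split_ordP i) => i' ->.
    have -> : lshift m (lshift n i') = lshift (n + m) i' by exact: val_inj.
    by rewrite EE; case: (split_ordP j) => j' ->; rewrite !(block_mxEul, block_mxEur) // !mxE.
  have -> : lshift m (rshift 1 i') = rshift 1 (lshift m i') by exact: val_inj.
  by rewrite EE; case: (split_ordP j) => j' ->; rewrite !(block_mxEdl, block_mxEdr) // !mxE.
have EB : dsubmx E = row_mx tB uB.
  apply/matrixP => i j; rewrite mxE.
  have -> : rshift (1 + n) i = rshift 1 (rshift n i) by exact: val_inj.
  by rewrite EE; case: (split_ordP j) => j' ->; rewrite ?(block_mxEdl, block_mxEdr) ?row_mxEl ?row_mxEr // !mxE.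
have aE : a = row_mx aA aB by rewrite hsubmxK.
have tE : t = col_mx tA tB by rewrite vsubmxK.
have uE : u = col_mx uA uB by rewrite vsubmxK.
have atE : a *m t = aA *m tA + aB *m tB by rewrite {1}aE {1}tE mul_row_col.
have auE : a *m u = aA *m uA + aB *m uB by rewrite {1}aE {1}uE mul_row_col.
have aB_ge0 : nneg aB by move=> i j; rewrite mxE a0.
(* Fewer than [D] coefficients are small, each is at most 1/(2D), and the entries of [t] are at most
   1; so at least half of the first coordinate remains, as [corner] requires. *)
have aBt : 0 <= (aB *m tB) 0 0 <= 2^-1.
  rewrite mxE; apply/andP; split.
    by apply: sumr_ge0 => k _; rewrite mulr_ge0 ?aB_ge0 // mxE; case/andP: (t01 (rshift n k)).
  apply: (@le_trans _ _ (\sum_(k < m) (2 * D%:R)^-1)).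
    apply: ler_sum => k _; rewrite !mxE.
    have /andP[tk0 tk1] := t01 (rshift n k).
    have : a 0 (rshift n k) <= (2 * D%:R)^-1.
      by rewrite leNgt; apply/negP => /ltW; rewrite -an /= ltnNge leq_addr.
    move=> ak; rewrite -[X in _ <= X]mulr1 ler_pM //; exact: a0.
  rewrite sumr_const card_ord -[X in X <= _]mulr_natl ler_pdivrMr ?mulr_gt0 // mulKf ?pnatr_eq0 //.
  rewrite ler_nat (leq_trans _ nmD) //; clear; lia.
have uB_ge0 : nneg uB by move=> i j; rewrite mxE u0.
have [|i|i j|i||i|U [Uu U0 UT Ux]] := @corner R n (n + m) D L g tA uA beta aA _ DL g1.
- by apply: leq_trans nmD; clear; lia.
- by rewrite mxE.
- by rewrite mxE u0.
- by rewrite mxE -an /= ltn_ord.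
- by move: y01 aBt; rewrite atE [X in _ + X = _]mxE => h0 /andP[h1 h2]; apply/andP; split; lra.
- apply: le_trans (au1 i); rewrite auE [X in _ <= X]mxE lerDl mxE.
  by apply: sumr_ge0 => k _; rewrite mulr_ge0 ?aB_ge0 ?uB_ge0.
rewrite -/T -EA in U0 UT Ux.
pose V : 'M[int]_(1 + n + m) := block_mx U 0 0 1%:M.
have Vu : V \in unitmx by rewrite unitmxE /V det_ublock det1 mulr1 -unitmxE.
have VE : V^r *m E = col_mx (U^r *m usubmx E) (dsubmx E).
  rewrite /V map_block_mx !map_mx0 map_mx1 -{1}[E]vsubmxK mul_block_col.
  by rewrite !mul0mx mul1mx addr0 add0r.
have dsubE i j : 0 <= dsubmx E i j <= T.
  rewrite EB; case: (split_ordP j) => j' ->; rewrite ?row_mxEl ?row_mxEr mxE.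
    by rewrite (ord1 j'); have /andP[-> h] := t01 (rshift n i); apply: le_trans T1.
  by rewrite u0 uT.
have VT (i : 'I_(1 + n + m)) j : 0 <= (V^r *m E) i j <= T.
  rewrite VE; case: (split_ordP i) => i' ->; first by rewrite col_mxEu U0 UT.
  by rewrite col_mxEd dsubE.
exists (V *m M); rewrite map_mxM -mulmxA -/E; split.
- by rewrite unitmx_mul; apply/andP; split.
- by move=> i j; case/andP: (VT i j).
- by move=> i j; case/andP: (VT i j).
have -> : row_mx beta%:M a *m (M^r *m B) = row_mx beta%:M aA *m usubmx E + aB *m dsubmx E.
  rewrite ME EA EB !mul_row_block mul_mx_row add_row_mx !mulmx0 !add0r.
  by rewrite {1}atE {1}auE addrA.
by apply: (@extend_cone R (1 + n) m _ E U _ _ Ux); exists aB.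
Qed.

Lemma nonincreasing_cut (R : realType) (n : nat) (f : 'I_n -> R) (e : R) :
  (forall i j : 'I_n, (i <= j)%N -> f j <= f i) ->
  exists2 p, (p <= n)%N & forall i : 'I_n, (i < p)%N = (e <= f i).
Proof.
move=> f_dec; case: (pickP [pred i | f i < e]) => [i0 /= fi0|no]; last first.
  by exists n => // i; have /= := no i; rewrite ltn_ord ltNge => /negbFE ->.
case: (@arg_minnP _ i0 [pred i | f i < e] (@nat_of_ord n) fi0) => p /= fp pmin.
exists p; first exact: ltnW.
move=> i; apply/idP/idP => h.
  by rewrite leNgt; apply/negP => /pmin; rewrite leqNgt h.
by rewrite ltnNge; apply/negP => /f_dec; rewrite leNgt (lt_le_trans fp h).
Qed.

(* Projecting along the first coordinate axis and lifting a basis of the projected lattice gives a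
   basis of the lattice whose cone may miss [x] only because the coefficient [beta] is negative. *)
Lemma cone_step (R : realType) (d D L : nat) :
  (1 + d <= D)%N -> (D <= 2 ^ L)%N ->
  (forall (Z : 'M[int]_d) (B : 'M[R]_d), Z^r *m B = 1%:M ->
    forall x, nneg x -> has_cone (2 ^+ cone_exp D L) B x) ->
  forall (Z : 'M[int]_(1 + d)) (B : 'M[R]_(1 + d)), Z^r *m B = 1%:M ->
    forall x : 'rV[R]_(1 + d), nneg x -> x 0 (lshift d 0) = 1 -> (forall i, x 0 i <= 1) ->
    has_cone (2 ^+ cone_exp D L) B x.
Proof.
move=> dD DL IH Z B ZB x x0 x1 x_le.
set T := 2 ^+ _ in IH *.
have T1 : 1 <= T by rewrite exprn_ege1 // ler1n.
pose e0 : 'rV[R]_(1 + d) := row_mx 1%:M 0.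
have rowZ : (row 0 Z)^r *m B = e0.
  have -> : (row 0 Z)^r = row 0 (Z^r : 'M[R]_(1 + d)) by apply/rowP => j; rewrite !mxE.
  rewrite -row_mul ZB; apply/rowP => j; rewrite /e0.
  by case: (split_ordP j) => j' ->; rewrite ?row_mxEl ?row_mxEr !mxE.
have z0 : row 0 Z != 0.
  apply/eqP => z0; have /rowP/(_ (lshift d 0)) := rowZ.
  rewrite z0 map_mx0 mul0mx row_mxEl !mxE eqxx => /eqP; by rewrite eq_sym oner_eq0.
(* The first unit vector lies in the lattice; the primitive vector [g^-1 *: e0] in its direction
   becomes the first basis vector. *)
have [W [gz gz0 [Wu zW]]] := primitive_row z0.
pose g : R := gz%:~R.
have g1 : 1 <= g by rewrite ler1z; exact: gz0.
have g_gt0 : 0 < g by apply: lt_le_trans g1.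
pose E0 : 'M[R]_(1 + d) := W^r *m B.
pose t0 := dlsubmx E0; pose B' := drsubmx E0.
have E0E : E0 = block_mx g^-1%:M 0 t0 B'.
  have uE : usubmx E0 = row_mx g^-1%:M 0.
    have gW : g *: ((row 0 W)^r *m B) = e0.
      rewrite -rowZ zW scalemxAl; congr (_ *m _); apply/rowP => j; by rewrite !mxE rmorphM.
    have -> : usubmx E0 = (row 0 W)^r *m B.
      rewrite /E0 -mul_usub_mx; congr (_ *m _); apply/matrixP => i j; rewrite !mxE (ord1 i).
      by congr ((W _ _)%:~R); exact: val_inj.
    have -> : row_mx g^-1%:M 0 = g^-1 *: e0.
      by rewrite /e0 scale_row_mx scaler0 scale_scalar_mx mulr1.
    by rewrite -gW scalerA mulVf ?scale1r // gt_eqF.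
  by rewrite -[LHS]vsubmxK uE -[dsubmx E0]hsubmxK.
pose Y : 'M[int]_(1 + d) := Z *m invmx W.
have YE : Y^r *m E0 = 1%:M.
  rewrite /Y /E0 mulmxA -map_mxM -mulmxA mulVmx // mulmx1; exact: ZB.
(* The projected lattice again contains the standard lattice, so the induction hypothesis applies to
   it. *)
have Z'B' : (drsubmx Y)^r *m B' = 1%:M.
  have := congr1 (@drsubmx _ 1 d 1 d) YE; rewrite E0E -{1}[Y]submxK map_block_mx.
  rewrite mulmx_block block_mxKdr mulmx0 add0r => ->.
  by apply/matrixP => i j; rewrite !mxE.
pose x' := rsubmx x.
have x'0 : nneg x' by move=> i j; rewrite mxE x0.
have [U' [U'u U'0 U'T [a' a'0 x'E]]] := IH _ _ Z'B' x' x'0.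
have [s s_dec] := sort_perm (a' 0).
pose U2 := row_perm s U'; pose a := col_perm s a'.
pose u := U2^r *m B'.
have U2u : U2 \in unitmx by rewrite /U2 row_permE unitmx_mul unitmx_perm.
have uE i j : u i j = (U'^r *m B') (s i) j.
  by rewrite !mxE; apply: eq_bigr => k _; rewrite !mxE.
have u0 : nneg u by move=> i j; rewrite uE.
have uT i j : u i j <= T by rewrite uE.
have a0 : nneg a by move=> i j; rewrite mxE a'0.
have xau : x' = a *m u.
  rewrite x'E; apply/rowP => j; rewrite [LHS]mxE [RHS]mxE (reindex_inj (@perm_inj _ s)) /=.
  by apply: eq_bigr => k _; rewrite uE [a _ _]mxE.
(* The lifts are shifted by multiples of [g^-1 *: e0] until their first coordinates lie between 0
   and [g^-1], hence in [0, 1]. *)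
pose mz : 'cV[int]_d := \col_k Num.floor (g * (U2^r *m t0) k 0).
pose t := U2^r *m t0 - g^-1 *: mz^r.
have t01 i : 0 <= t i 0 <= 1.
  have -> : t i 0 = (U2^r *m t0) i 0 - g^-1 * (mz i 0)%:~R by rewrite [LHS]mxE [X in _ + X]mxE [X in - X]mxE [X in _ * X]mxE.
  have -> : mz i 0 = Num.floor (g * (U2^r *m t0) i 0) by rewrite [LHS]mxE.
  set y := (_ *m _) i 0; have := floor_itv (g * y); rewrite intrD => /andP[h1 h2].
  have -> : y - g^-1 * (Num.floor (g * y))%:~R = g^-1 * (g * y - (Num.floor (g * y))%:~R).
    by field; rewrite gt_eqF.
  rewrite mulr_ge0 ?invr_ge0 ?(ltW g_gt0) ?subr_ge0 //=.
  rewrite mulrC ler_pdivrMr // mul1r; lra.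
pose M : 'M[int]_(1 + d) := block_mx 1%:M 0 (- mz) U2 *m W.
have Mu : M \in unitmx.
  by rewrite unitmx_mul Wu andbT unitmxE det_lblock det1 mul1r -unitmxE.
have ME : M^r *m B = block_mx g^-1%:M 0 t u.
  rewrite /M map_mxM -mulmxA -/E0 E0E map_block_mx mulmx_block map_mx1 map_mx0 map_mxN.
  rewrite !mul0mx !mulmx0 !addr0 !add0r mul1mx; congr block_mx.
  by rewrite mul_mx_scalar scalerN addrC.
(* The first coordinate 1 of [x] forces this coefficient; if it is nonnegative, the lifted basis
   itself serves. *)
pose beta := g * (1 - (a *m t) 0 0).
have xE : x = row_mx beta%:M a *m (M^r *m B).
  rewrite ME mul_row_block mulmx0 add0r -[LHS]hsubmxK -xau; congr row_mx.
  apply/rowP => j; rewrite (ord1 j) mxE x1 mul_mx_scalar scale_scalar_mx [RHS]mxE [X in X + _]mxE.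
  rewrite eqxx mulr1n /beta; field; by rewrite gt_eqF.
have [b0|b0] := lerP 0 beta.
  have E_itv i j : 0 <= (M^r *m B) i j <= T.
    rewrite ME; case: (split_ordP i) => i' ->; case: (split_ordP j) => j' ->.
    - rewrite block_mxEul (ord1 i') (ord1 j') mxE eqxx mulr1n invr_ge0 (ltW g_gt0) /=.
      by apply: le_trans T1; rewrite invf_le1.
    - by rewrite block_mxEur mxE lexx (le_trans ler01).
    - by rewrite block_mxEdl (ord1 j'); have /andP[-> h] := t01 i'; apply: le_trans T1.
    - by rewrite block_mxEdr u0 uT.
  exists M; split=> //; try by move=> i j; case/andP: (E_itv i j).
  exists (row_mx beta%:M a) => // i j.
  case: (split_ordP j) => j' ->; rewrite ?row_mxEl ?row_mxEr ?a0 // mxE (ord1 i) (ord1 j').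
  by rewrite eqxx mulr1n.
have a_dec (i j : 'I_d) : (i <= j)%N -> a 0 j <= a 0 i by rewrite ![a _ _]mxE; exact: s_dec.
have [p pd pP] := nonincreasing_cut (2 * D%:R)^-1 a_dec.
have y1 : beta / g + (a *m t) 0 0 = 1.
  by rewrite /beta; field; rewrite gt_eqF.
have au1 i : (a *m u) 0 i <= 1 by rewrite -xau mxE.
rewrite xE /T in uT *; clear - dD DL g1 t01 u0 uT a0 pd pP y1 au1 Mu ME.
clearbody beta g t u a M.
have [m dE] : exists m, d = (p + m)%N by exists (d - p)%N; rewrite subnKC.
by subst d; exact: (@cone_split R p m D L g beta t u a M B dD DL g1 t01 u0 uT a0 pP y1 au1 Mu ME).
Qed.

(* The hypothesis on [Z] says that the lattice spanned by the rows of [B] contains the standard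
   lattice; the cone to be covered is the nonnegative orthant. *)
Lemma unimodular_cone (R : realType) (D L : nat) : (D <= 2 ^ L)%N ->
  forall d, (d <= D)%N -> forall (Z : 'M[int]_d) (B : 'M[R]_d), Z^r *m B = 1%:M ->
    forall x, nneg x -> has_cone (2 ^+ cone_exp D L) B x.
Proof.
move=> DL; elim=> [|d IH] dD Z B ZB x x0.
  exists 1%:M; split; try by [rewrite unitmx1|move=> i; case: (i)].
  by exists 0 => [i j|]; rewrite ?mxE //; apply/rowP; case.
have step := @cone_step R d D L dD DL (IH (ltnW dD)).
(* A transposition of the coordinates moves a largest one, normalized to 1, to the front. *)
have scaled (y : 'rV[R]_d.+1) i : nneg y -> y 0 i = 1 -> (forall k, y 0 k <= 1) ->
    has_cone (2 ^+ cone_exp D L) B y.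
  move=> y0 y1 y_le; pose P : 'M[int]_d.+1 := tperm_mx 0 i.
  have PP : P *m P = 1%:M by rewrite -perm_mxM tperm2 perm_mx1.
  have PPr : P^r *m P^r = 1%:M :> 'M[R]_d.+1 by rewrite -map_mxM PP map_mx1.
  have colP m (A : 'M[R]_(m, d.+1)) k l : (A *m P^r) k l = A k (tperm 0 i l).
    by rewrite map_perm_mx -{1}(tpermV 0 i) -col_permE mxE.
  have [||||U [Uu U0 UT [c c0 cE]]] := step (P *m Z) (B *m P^r) _ (y *m P^r).
  - by rewrite map_mxM -mulmxA [Z^r *m _]mulmxA ZB mul1mx PPr.
  - by move=> k l; rewrite colP y0.
  - by rewrite colP (_ : lshift d 0 = 0) ?tpermL //; exact: val_inj.
  - by move=> l; rewrite colP y_le.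
  exists U; split=> //.
  - by move=> k l; have := U0 k (tperm 0 i l); rewrite mulmxA colP tpermK.
  - by move=> k l; have := UT k (tperm 0 i l); rewrite mulmxA colP tpermK.
  - by exists c => //; rewrite -[y]mulmx1 -PPr mulmxA cE -!mulmxA PPr mulmx1.
have [k _ kmax] := @arg_maxP _ R 'I_d.+1 0 predT (x 0) isT.
have [xk|xk] := eqVneq (x 0 k) 0.
  have [|||U [Uu U0 UT _]] := scaled (const_mx 1) 0; try by move=> *; rewrite mxE.
  exists U; split=> //; exists 0 => [i j|]; rewrite ?mxE //.
  rewrite mul0mx; apply/rowP => i; rewrite mxE; apply/eqP; rewrite eq_le (x0 0 i) andbT -xk.
  exact: kmax.
have xk0 : 0 < x 0 k by rewrite lt0r xk x0.
have [|||U [Uu U0 UT [c c0 cE]]] := scaled ((x 0 k)^-1 *: x) k.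
- by move=> i j; rewrite mxE mulr_ge0 ?invr_ge0 ?x0.
- by rewrite mxE mulVf.
- by move=> i; rewrite mxE mulrC ler_pdivrMr // mul1r; exact: kmax.
exists U; split=> //; exists (x 0 k *: c); first by move=> i j; rewrite mxE mulr_ge0 ?c0.
by rewrite -scalemxAl -cE scalerA mulfV // scale1r.
Qed.

(** * Reduction from a polytope to a simplex *)

(* Caratheodory's theorem for a cone spanning the whole space, in the form of the reduction to a
   basic solution in linear programming. *)
Lemma basic_solution (R : realType) (n D : nat) (M : 'M[R]_(n, D)) (w : 'rV[R]_n) :
  row_full M -> nneg w ->
  exists2 f : 'I_D -> 'I_n, rowsub f M \in unitmx & in_cone (rowsub f M) (w *m M).
Proof.
elim: n M w => [|n IH] M w Mf w0.
  have D0 : D = 0%N by apply/eqP; rewrite -leqn0 -(eqP Mf) rank_leq_row.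
  subst D; exists id; first by rewrite unitmxE det_mx00 unitr1.
  by exists w => //; apply/rowP => -[].
case: (ltnP D n.+1) => [Dn|nD]; last first.
  have DE : D = n.+1 by apply/eqP; rewrite eqn_leq nD -{1}(eqP Mf) rank_leq_row.
  subst D; exists id; last by exists w; rewrite // mxsub_id.
  by rewrite mxsub_id -row_full_unit.
(* A relation between the rows with a positive coefficient; subtracting the multiple [q] of it given
   by the least ratio makes the coefficient at [k] vanish while all stay nonnegative. *)
have [z z_gt0 zM] : exists2 z : 'rV[R]_n.+1, exists k, 0 < z 0 k & z *m M = 0.
  have : ~~ row_free M by rewrite /row_free (eqP Mf) neq_ltn Dn.
  rewrite -kermx_eq0 => /rowV0Pn[z /sub_kermxP zM /rV0Pn[k zk]].
  have [zk0|zk0] := ltrP 0 (z 0 k); first by exists z => //; exists k.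
  exists (- z); last by rewrite mulNmx zM oppr0.
  by exists k; rewrite mxE oppr_gt0 lt_neqAle zk.
case: z_gt0 => k0 zk0.
have [k /= zk kmin] := @arg_minP _ R 'I_n.+1 k0 [pred i | 0 < z 0 i] (fun i => w 0 i / z 0 i) zk0.
set q := w 0 k / z 0 k in kmin.
pose w' := w - q *: z.
have w'E i : w' 0 i = w 0 i - q * z 0 i by rewrite !mxE.
have q0 : 0 <= q by rewrite divr_ge0 ?w0 // ltW.
have w'0 i : 0 <= w' 0 i.
  rewrite w'E subr_ge0; have [zi|zi] := ltrP 0 (z 0 i).
    by rewrite -ler_pdivlMr // kmin.
  by apply: le_trans (w0 0 i); rewrite mulr_ge0_le0.
have w'k : w' 0 k = 0 by rewrite w'E /q divfK ?subrr // gt_eqF.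
have wM : w *m M = w' *m M by rewrite mulmxBl -scalemxAl zM scaler0 subr0.
have wM' : w *m M = col' k w' *m row' k M.
  rewrite wM; apply/rowP => j; rewrite mxE (bigD1_ord k) //= w'k mul0r add0r [RHS]mxE.
  by apply: eq_bigr => i _; rewrite !mxE.
have M'f : row_full (row' k M).
  have rk : (row k M <= row' k M)%MS.
    apply/submxP; exists (- (z 0 k)^-1 *: col' k z); apply/rowP => j.
    have /rowP/(_ j) := zM; rewrite mxE (bigD1_ord k) //= [X in _ = X]mxE => /eqP.
    rewrite addr_eq0 => /eqP e; rewrite -scalemxAl mxE [RHS]mxE [X in _ = _ * X]mxE.
    have -> : \sum_j0 col' k z 0 j0 * row' k M j0 j = - (z 0 k * M k j).
      rewrite e opprK; apply: eq_bigr => i _; by rewrite !mxE.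
    by field; rewrite gt_eqF.
  have MM : (M <= row' k M)%MS.
    apply/row_subP => i; case: (unliftP k i) => [i' ->|->] //.
    by rewrite (_ : row _ _ = row i' (row' k M)) ?row_sub //; apply/rowP => j; rewrite !mxE.
  by rewrite -col_leq_rank -{1}(eqP Mf); exact: mxrankS.
have w''0 : nneg (col' k w') by move=> i j; rewrite mxE (ord1 i).
have [f fu fc] := IH _ _ M'f w''0.
have fE : rowsub f (row' k M) = rowsub (lift k \o f) M by apply/matrixP => i j; rewrite !mxE.
by exists (lift k \o f); rewrite -fE // wM'.
Qed.

(** Subtracting the first row from the others passes from homogeneous coordinates of points to edge
    vectors. *)
Lemma det_affine (R : realType) (d : nat) (a : 'rV[R]_d) (X : 'M[R]_d) :
  \det (block_mx 1%:M a (const_mx 1) X : 'M[R]_(1 + d)) = \det (X - const_mx 1 *m a).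
Proof.
have := det_mulmx (block_mx 1%:M 0 (- const_mx 1) 1%:M : 'M[R]_(1 + d)) (block_mx 1%:M a (const_mx 1) X).
rewrite mulmx_block !mul1mx !mul0mx !addr0 mulmx1 addNr det_ublock det_lblock !det1 !mul1r => <-.
by rewrite mulNmx addrC.
Qed.

(** With a coordinate 1 put in front of every vertex, convex combinations become conical ones and
    [basic_solution] applies. A vertex of largest weight is moved to index [ord0]. *)
Lemma simplex_reduction (R : realType) (d : nat) (P : ('I_d -> R) -> Prop) (x : 'I_d -> R) :
  lattice_polytope P -> full_dim P -> P x ->
  exists2 v : 'I_d.+1 -> 'I_d -> int,
    ((\matrix_(i, j) (v (lift ord0 i) j - v ord0 j) : 'M[int]_d)^r : 'M[R]_d) \in unitmx &
    (forall y, conv (fun i => lpt R (v i)) y -> P y) /\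
    exists w : 'I_d.+1 -> R, [/\ forall i, 0 <= w i, \sum_i w i = 1,
      forall i, w i <= w ord0 & forall j, x j = \sum_i w i * (v i j)%:~R].
Proof.
move=> [n [v [n0 vP]]] [x0 [xs [Px0 [Pxs det0]]]] Px.
pose M : 'M[R]_(n, 1 + d) := row_mx (const_mx 1) (\matrix_(i, j) (v i j)%:~R).
have convM y (Py : P y) : exists2 w : 'rV[R]_n, nneg w & w *m M = row_mx 1%:M (\row_j y j).
  have [w [w0 [w1 wy]]] := (vP y).1 Py; exists (\row_i w i); first by move=> i j; rewrite mxE.
  rewrite mul_mx_row; congr row_mx; apply/rowP => j.
    rewrite (ord1 j) mxE; transitivity (\sum_i w i); last by rewrite w1 mxE eqxx.
    by apply: eq_bigr => i _; rewrite !mxE mulr1.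
  by rewrite !mxE wy; apply: eq_bigr => i _; rewrite !mxE.
(* The homogenized points [x0] and [xs i] of [full_dim] form an invertible matrix whose rows are
   combinations of the rows of [M]. *)
have Mf : row_full M.
  pose A : 'M[R]_(1 + d) := block_mx 1%:M (\row_j x0 j) (const_mx 1) (\matrix_(i, j) xs i j).
  have Au : A \in unitmx.
    rewrite unitmxE det_affine unitfE; move: det0; congr (\det _ != 0).
    by apply/matrixP => i j; rewrite !mxE big_ord1 !mxE mul1r.
  have AM : (A <= M)%MS.
    apply/row_subP => i; case: (split_ordP i) => i' ->.
      have [w _ wM] := convM _ Px0; apply/submxP; exists w; rewrite wM.
      by rewrite rowKu row_row_mx; congr row_mx; apply/rowP => j; rewrite !mxE ?(ord1 i').
    have [w _ wM] := convM _ (Pxs i'); apply/submxP; exists w; rewrite wM.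
    by rewrite rowKd row_row_mx; congr row_mx; apply/rowP => j; rewrite !mxE ?(ord1 j).
  by rewrite -col_leq_rank -{1}(mxrank_unit Au); exact: mxrankS.
have [w w0 wM] := convM _ Px.
have [f fu [c c0 cE]] := basic_solution Mf w0.
rewrite wM in cE.
have [k _ kmax] := @arg_maxP _ R 'I_d.+1 ord0 predT (c 0) isT.
pose s := tperm ord0 k.
pose u i := v (f (s i)).
have cx j : x j = \sum_i c 0 (s i) * (u i j)%:~R.
  have /rowP/(_ (rshift 1 j)) := cE; rewrite row_mxEr [LHS]mxE [RHS]mxE => ->.
  rewrite [LHS](reindex_inj (@perm_inj _ s)); apply: eq_bigr => i _.
  by rewrite mxE row_mxEr mxE.
have c1 : \sum_i c 0 (s i) = 1.
  have /rowP/(_ (lshift d 0)) := cE; rewrite row_mxEl mxE eqxx mulr1n mxE => e; rewrite [RHS]e.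
  rewrite [RHS](reindex_inj (@perm_inj _ s)); apply: eq_bigr => i _.
  by rewrite mxE row_mxEl mxE mulr1.
exists u.
  have fsu : rowsub (f \o s) M \in unitmx.
    have -> : rowsub (f \o s) M = perm_mx s *m rowsub f M.
      by rewrite -row_permE; apply/matrixP => i j; rewrite !mxE.
    by rewrite unitmx_mul unitmx_perm.
  move: fsu; rewrite !unitmxE !unitfE.
  pose Q : 'M[R]_(1 + d) :=
    block_mx 1%:M (\row_j (u ord0 j)%:~R) (const_mx 1) (\matrix_(i, j) (u (lift ord0 i) j)%:~R).
  have QE (i : 'I_(1 + d)) j : Q i j = M (f (s i)) j.
    case: (split_ordP i) => i' ->; case: (split_ordP j) => j' ->.
    - by rewrite row_mxEl block_mxEul !mxE (ord1 i') (ord1 j') eqxx.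
    - rewrite row_mxEr block_mxEur !mxE /u (_ : lshift d i' = ord0) //.
      by apply: val_inj; rewrite /= (ord1 i').
    - by rewrite row_mxEl block_mxEdl !mxE.
    - rewrite row_mxEr block_mxEdr !mxE /u (_ : rshift 1 i' = lift ord0 i') //.
      exact: val_inj.
  have -> : rowsub (f \o s) M = Q by apply/matrixP => i j; rewrite mxE; exact/esym/QE.
  rewrite det_affine; congr (\det _ != 0).
  by apply/matrixP => i j; rewrite !mxE big_ord1 !mxE mul1r rmorphB.
split; last first.
  exists (fun i => c 0 (s i)); split=> //.
  by move=> i; rewrite /s tpermL; exact: kmax.
move=> y [mu [mu0 [mu1 muy]]]; apply/vP.
exists (fun i => \sum_(j | f (s j) == i) mu j); split.
  by move=> i; apply: sumr_ge0.
split; first by rewrite -mu1 (partition_big (fun j => f (s j)) predT).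
move=> j; rewrite muy (partition_big (fun j => f (s j)) predT) //=; apply: eq_bigr => i _.
by rewrite mulr_suml; apply: eq_bigr => l /eqP <-.
Qed.


(** * The Kuhn triangulation, and an explicit admissible factor *)

Lemma sum_tail (V : zmodType) (n : nat) (F : nat -> V) (p : nat) : (p <= n)%N ->
  \sum_(i < n | (p <= i)%N) (F i - F i.+1) = F p - F n.
Proof.
move=> pn; have /= <- := big_geq_mkord p n predT (fun i => F i - F i.+1).
by rewrite -[RHS]opprB -(telescope_sumr F pn) -sumrN; apply: eq_bigr => i _; rewrite opprB.
Qed.

(* The simplex of the standard (Kuhn) triangulation of a unit cube that contains [a]. *)
Lemma kuhn (R : realType) (d : nat) (a : 'rV[R]_d) : nneg a ->
  exists n : 'I_d.+1 -> 'rV[int]_d, [/\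
    forall j k, 0 <= ((n j 0 k)%:~R : R) <= a 0 k + 1,
    forall z : 'rV[int]_d, exists c : 'I_d -> int,
      z = \sum_i c i *: (n (lift ord0 i) - n ord0) &
    exists w : 'I_d.+1 -> R, [/\ forall j, 0 <= w j, \sum_j w j = 1 &
      a = \sum_j w j *: (n j)^r]].
Proof.
move=> a0; pose f k := a 0 k - (Num.floor (a 0 k))%:~R.
have f01 k : 0 <= f k < 1.
  by have := floor_itv (a 0 k); rewrite intrD /f => /andP[h1 h2]; apply/andP; split; lra.
have [s s_dec] := sort_perm f.
(* Starting from the floor of [a], the coordinates are raised by 1 in the order of decreasing
   fractional part; [s^-1%g k] is the position of [k] in this order. *)
pose n (j : 'I_d.+1) : 'rV[int]_d :=
  \row_k (Num.floor (a 0 k) + ((s^-1%g k < j)%N : nat)%:Z).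
have nE j k : n j 0 k = Num.floor (a 0 k) + ((s^-1%g k < j)%N : nat)%:Z by rewrite mxE.
exists n; split.
- move=> j k; rewrite nE rmorphD /= -pmulrn; have /andP[f0 f1] := f01 k.
  have fl0 : 0 <= (Num.floor (a 0 k))%:~R :> R by rewrite ler0z floor_ge0 a0.
  move: f0 f1; rewrite /f => f0 f1.
  by case: (_ < _)%N; rewrite /= ?mulr1n ?mulr0n; apply/andP; split; lra.
(* The edges from [n ord0] are partial sums of the unit vectors in sorted order, so the coefficients
   are consecutive differences of the sorted coordinates of [z], with 0 appended. *)
- move=> z; pose m i : int := if insub i is Some k then z 0 (s k) else 0.
  exists (fun i : 'I_d => m i - m i.+1); apply/rowP => k; rewrite summxE.
  transitivity (\sum_(i < d | (s^-1%g k <= i)%N) (m i - m i.+1)).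
    rewrite sum_tail; last exact: ltnW.
    by rewrite /m valK permKV insubF ?ltnn // subr0.
  rewrite [LHS]big_mkcond; apply: eq_bigr => i _; rewrite !mxE /bump /= ?add1n ltnS ?ltn0 addr0.
  by rewrite addrC addKr; case: (_ <= _)%N; rewrite ?mulr1 ?mulr0.
(* The sorted fractional parts, preceded by 1 and followed by 0; their consecutive differences are
   the weights of the vertices. *)
pose g i : R := if i is i'.+1 then if insub i' is Some k then f (s k) else 0 else 1.
have g0 i : 0 <= g i.
  by case: i => [|i] //=; case: insubP => //= k _ _; have /andP[] := f01 (s k).
have g_dec i : g i.+1 <= g i.
  case: i => [|i] /=; first by case: insubP => [k _ _|_]; rewrite ?ler01 // ltW //; have /andP[] := f01 (s k).
  case: insubP => [k ki kE|_]; last exact: (g0 i.+1).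
  have id : (i < d)%N by exact: ltnW.
  by rewrite insubT /=; apply: s_dec; rewrite /= kE.
have gd : g d.+1 = 0 by rewrite /g insubF // ltnn.
exists (fun j => g j - g j.+1); split.
- by move=> j; rewrite subr_ge0.
- have := @sum_tail R d.+1 g 0 isT; rewrite gd subr0 -[X in _ = X -> _]/1 => e.
  by rewrite -[RHS]e; apply: eq_bigl.
apply/rowP => k; rewrite summxE.
transitivity (\sum_(j < d.+1) ((g j - g j.+1) * (Num.floor (a 0 k))%:~R +
   (if (s^-1%g k < j)%N then g j - g j.+1 else 0))).
  rewrite big_split -mulr_suml -big_mkcond sum_tail ?ltnS; last exact: ltnW.
  have := @sum_tail R d.+1 g 0 isT; rewrite gd subr0 => e.
  have -> : \sum_(j < d.+1) (g j - g j.+1) = 1 by rewrite -[RHS]e; apply: eq_bigl.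
  by rewrite mul1r subr0 /g valK permKV /f [RHS]addrC subrK.
apply: eq_bigr => j _; rewrite mxE [(n j)^r _ _]mxE nE rmorphD /= mulrDr; congr (_ + _).
by case: (_ < _)%N; rewrite /= ?mulr1 ?mulr0.
Qed.

(** In edge coordinates at the vertex of largest weight, the opposite facet is where the coordinate
    sum is [C], and the given point stays at least C/(d+1) below it. The vertices of the unimodular
    simplex around the point exceed its coordinate sum by at most d^2 T, which explains the factor
    d^2 (d+1). *)
Lemma cpol_admissible_bound (R : realType) (d L : nat) : (0 < d)%N -> (d <= 2 ^ L)%N ->
  cpol_admissible R d (d ^ 2 * d.+1 * 2 ^ cone_exp d L).
Proof.
move=> d0 dL C cC P latP fullP x; split; last by case=> v [_ [vP vx]]; exact: vP.
case=> y [Py xy].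
have [v Vu [vP [w [w0 w1 wmax yw]]]] := simplex_reduction latP fullP Py.
pose V : 'M[int]_d := \matrix_(i, j) (v (lift ord0 i) j - v ord0 j).
pose T : R := 2 ^+ cone_exp d L.
(* The rows of [B] are the unit vectors of Z^d in edge coordinates, and [V^r *m B = 1%:M] expresses
   that the edges are lattice vectors. *)
pose B : 'M[R]_d := invmx V^r.
have C0 : 0 < C%:R :> R by rewrite ltr0n (leq_trans _ cC) // !muln_gt0 ?expn_gt0 d0.
pose q : 'rV[R]_d := \row_i (C%:R * w (lift ord0 i)).
have q0 : nneg q by move=> i j; rewrite mxE mulr_ge0 // ltW.
have [U [Uu U0 UT [a a0 qE]]] := unimodular_cone dL (leqnn d) (mulmxV Vu) q0.
rewrite -/B in U0 UT qE.
have [n [n_itv n_gen [mu [mu0 mu1 aE]]]] := kuhn a0.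
(* [ver j] is a lattice point, and [eta j] is its position relative to [C] times [v ord0] in edge
   coordinates. *)
pose ver (j : 'I_d.+1) : 'rV[int]_d := C%:Z *: (\row_l v ord0 l) + n j *m U.
pose eta (j : 'I_d.+1) : 'rV[R]_d := (n j)^r *m (U^r *m B).
have etaV j : eta j *m V^r = (n j *m U)^r by rewrite /eta -!mulmxA mulVmx // mulmx1 map_mxM.
have verE j l : (ver j 0 l)%:~R = C%:R * (v ord0 l)%:~R + (n j *m U)^r 0 l :> R.
  by rewrite [ver j 0 l]mxE rmorphD /= [X in _ = _ + X]mxE; congr (_ + _); rewrite !mxE rmorphM.
have eta0 j : nneg (eta j).
  move=> i k; rewrite mxE; apply: sumr_ge0 => l _; rewrite mulr_ge0 ?U0 //.
  by rewrite mxE (ord1 i); have /andP[] := n_itv j l.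
have w0_ge : 1 <= w ord0 * d.+1%:R.
  have -> : w ord0 * d.+1%:R = \sum_(i < d.+1) w ord0 by rewrite sumr_const card_ord mulr_natr.
  by rewrite -[X in X <= _]w1 ler_sum.
have eta_sum j : \sum_l eta j 0 l <= C%:R.
  apply: (@le_trans _ _ (\sum_(l < d) (q 0 l + d%:R * T))).
    apply: ler_sum => l _; rewrite qE !mxE.
    have -> : d%:R * T = \sum_(k < d) T by rewrite sumr_const card_ord mulr_natl.
    rewrite -big_split; apply: ler_sum => k _ /=.
    have /andP[_ nk] := n_itv j k; rewrite [X in X * _]mxE.
    apply: (@le_trans _ _ ((a 0 k + 1) * (U^r *m B) k l)); first by rewrite ler_wpM2r ?U0.
    by rewrite mulrDl mul1r lerD2l UT.
  rewrite big_split /= sumr_const card_ord -[X in _ + X <= _]mulr_natl.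
  have -> : \sum_(l < d) q 0 l = C%:R * (1 - w ord0).
    rewrite -[X in X - _]w1 big_ord_recl addrC addKr mulr_sumr; apply: eq_bigr => l _; by rewrite mxE.
  have : d%:R * (d%:R * T) * d.+1%:R <= C%:R :> R.
    apply: le_trans (_ : (d ^ 2 * d.+1 * 2 ^ cone_exp d L)%:R <= _); last by rewrite ler_nat.
    have -> : (d ^ 2 * d.+1 * 2 ^ cone_exp d L)%:R = d%:R * d%:R * d.+1%:R * T :> R.
      by rewrite natrM natrX natrM -mulnn natrM.
    have -> : d%:R * (d%:R * T) * d.+1%:R = d%:R * d%:R * d.+1%:R * T :> R by ring.
    exact: lexx.
  move=> hC; have : C%:R * 1 <= C%:R * (w ord0 * d.+1%:R) by rewrite ler_wpM2l // ltW.
  move=> h; suff : d%:R * (d%:R * T) <= C%:R * w ord0 by lra.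
  by rewrite -(@ler_pM2r _ d.+1%:R) ?ltr0n //; lra.
exists (fun j l => ver j 0 l); split; [|split].
- move=> z; have [c cE] := n_gen ((\row_l z l) *m invmx U); exists c => l.
  have zE : \row_l z l = (\sum_i c i *: (n (lift ord0 i) - n ord0)) *m U by rewrite -cE mulmxKV.
  have /rowP/(_ l) := zE; rewrite mulmx_suml summxE mxE => ->; apply: eq_bigr => i _.
  rewrite -scalemxAl mxE; congr (_ * _).
  by rewrite mulmxBl /ver !mxE; ring.
- move=> p [la [la0 [la1 pE]]].
  pose e := \sum_j la j *: eta j.
  have e0 l : 0 <= e 0 l.
    by rewrite summxE; apply: sumr_ge0 => j _; rewrite mxE mulr_ge0 ?eta0.
  have e_sum : \sum_l e 0 l <= C%:R.
    under eq_bigr do rewrite summxE.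
    have -> : C%:R = \sum_j la j * C%:R :> R by rewrite -mulr_suml la1 mul1r.
    rewrite exchange_big /=; apply: ler_sum => j _.
    under eq_bigr do rewrite mxE.
    by rewrite -mulr_sumr ler_wpM2l ?la0 ?eta_sum.
  exists (fun l => p l / C%:R); split; last by move=> l; rewrite mulrC divfK // gt_eqF.
  pose W i := if unlift ord0 i is Some k then e 0 k / C%:R else 1 - (\sum_l e 0 l) / C%:R.
  have W0 : W ord0 = 1 - (\sum_l e 0 l) / C%:R by rewrite /W unlift_none.
  have WS k : W (lift ord0 k) = e 0 k / C%:R by rewrite /W liftK.
  apply: vP; exists W; split; [|split].
  + move=> i; rewrite /W; case: unliftP => [k _|_]; first by rewrite divr_ge0 // ltW.
    by rewrite subr_ge0 ler_pdivrMr // mul1r.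
  + rewrite big_ord_recl W0 [X in _ + X](eq_bigr _ (fun k _ => WS k)).
    by rewrite -mulr_suml subrK.
  + move=> l; rewrite big_ord_recl W0 pE /lpt.
    have -> : \sum_j la j * (ver j 0 l)%:~R = C%:R * (v ord0 l)%:~R + (e *m V^r) 0 l.
      rewrite /e mulmx_suml summxE.
      have -> : C%:R * (v ord0 l)%:~R = \sum_j la j * (C%:R * (v ord0 l)%:~R) :> R.
        by rewrite -mulr_suml la1 mul1r.
      rewrite -big_split /=; apply: eq_bigr => j _.
      by rewrite -scalemxAl etaV [X in _ = _ + X]mxE -mulrDr verE.
    rewrite mulrDl mulrAC divff ?gt_eqF // mul1r mulrBl mul1r -addrA; congr (_ + _).
    rewrite mxE !mulr_suml -sumrN -big_split /=; apply: eq_bigr => k _.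
    by rewrite WS !mxE rmorphB /=; field; rewrite gt_eqF.
exists mu; split=> //; split=> // l.
have -> : x l = C%:R * (v ord0 l)%:~R + (q *m V^r) 0 l.
  rewrite xy yw big_ord_recl; have := w1; rewrite big_ord_recl => e.
  have -> : w ord0 = 1 - \sum_(i < d) w (lift ord0 i).
    by apply/eqP; rewrite -subr_eq0 opprB addrA e subrr.
  have -> : (q *m V^r) 0 l = C%:R * (\sum_(i < d) w (lift ord0 i) * (v (lift ord0 i) l)%:~R) -
                             C%:R * ((\sum_(i < d) w (lift ord0 i)) * (v ord0 l)%:~R).
    rewrite mxE mulr_suml !mulr_sumr -sumrB; apply: eq_bigr => i _.
    by rewrite !mxE rmorphB /=; ring.
  ring.
have -> : q = \sum_j mu j *: eta j.
  by rewrite qE aE mulmx_suml; apply: eq_bigr => j _; rewrite -scalemxAl.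
rewrite mulmx_suml summxE; have -> : C%:R * (v ord0 l)%:~R = \sum_j mu j * (C%:R * (v ord0 l)%:~R) :> R.
  by rewrite -mulr_suml mu1 mul1r.
rewrite -big_split; apply: eq_bigr => j _ /=.
by rewrite /lpt verE -scalemxAl etaV [X in _ + X = _]mxE -mulrDr.
Qed.

(** * Comparison of the bound with powers of 3/2 *)

Lemma pow5_le_exp2 (L : nat) : (L ^ 5 <= 5 ^ 5 * 2 ^ L)%N.
Proof.
(* This comes from m + 1 <= 2^m for m = [L %/ 5]; its fifth power gives the claim. *)
have h : (L <= 5 * 2 ^ (L %/ 5))%N.
  apply: (@leq_trans (5 * (L %/ 5).+1)); last by rewrite leq_mul2l ltn_expl // orbT.
  by rewrite mulnC ltnW // ltn_ceil.
apply: (@leq_trans ((5 * 2 ^ (L %/ 5)) ^ 5)); first by rewrite leq_exp2r.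
by rewrite expnMn leq_mul2l -expnM leq_exp2l // leq_divM orbT.
Qed.

Lemma pow4_le_exp2 (a : nat) : exists L0, forall L, (L0 <= L)%N -> (a * L ^ 4 <= 2 ^ L)%N.
Proof.
have [A [A0 AP]] : exists A, (0 < A)%N /\ forall L, (L ^ 5 <= A * 2 ^ L)%N.
  by exists (5 ^ 5)%N; split; [rewrite expn_gt0|exact: pow5_le_exp2].
exists (A * a)%N => L aL; rewrite -(leq_pmul2l A0) mulnA.
by apply: leq_trans (AP L); rewrite (expnS L 4) leq_mul2r aL orbT.
Qed.

(** With d^2 <= 2^(2L) and d + 1 <= 2^(L+1), the exponent becomes d L^2 + 2dL + 2L^2 + 13L + 2d +
    13. Each monomial is at most d L^2, and the coefficients add up to 33. *)
Lemma cpol_bound_exp (d L : nat) : (0 < d)%N -> (0 < L)%N -> (d <= 2 ^ L)%N ->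
  (d ^ 2 * d.+1 * 2 ^ cone_exp d L <= 2 ^ (33 * d * L ^ 2))%N.
Proof.
move=> d0 L0 dL.
apply: (@leq_trans (2 ^ (L * 2) * 2 ^ L.+1 * 2 ^ cone_exp d L)).
  rewrite !leq_mul //; first by rewrite expnM leq_exp2r.
  by rewrite expnS mul2n -addnn -addn1 leq_add // expn_gt0.
rewrite -!expnD leq_exp2l // /cone_exp.
have h1 : (1 <= d * L ^ 2)%N by rewrite muln_gt0 d0 expn_gt0 L0.
have h2 : (d * L <= d * L ^ 2)%N by rewrite leq_mul2l leq_pmulr ?orbT.
have h3 : (L ^ 2 <= d * L ^ 2)%N by rewrite leq_pmull.
have h4 : (L <= d * L ^ 2)%N by apply: leq_trans h2; rewrite leq_pmull.
have h5 : (d <= d * L ^ 2)%N by rewrite leq_pmulr // expn_gt0 L0.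
move: h1 h2 h3 h4 h5; rewrite -!mulnn; clear; nia.
Qed.

Theorem theorem1p1 (R : realType) :
  exists K : R, 0 < K /\
    forall d : nat, (1 < d)%N ->
      exists c : nat, cpol_admissible R d c /\
        (c%:R : R) <= K * (d%:R) ^+ 5 *
          (3 / 2 : R) ^ (Num.ceil (Num.sqrt ((d.-1)%:R : R)) * (d.-1)%:Z).
Proof.
(* Here 132 = 2 * 33 * 2: the 33 is that of [cpol_bound_exp], one 2 comes from 2 <= (3/2)^2 and the
   other from d <= 2(d - 1). *)
have [L0 L0P] := pow4_le_exp2 (2 * 132 ^ 2).
(* For [L < L0] the exponent is bounded, and the constant [2 ^+ e0] absorbs these cases. *)
have [e0 e0P] : exists e0, forall d L, (d <= 2 ^ L)%N -> (L < L0)%N -> (33 * d * L ^ 2 <= e0)%N.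
  exists (33 * 2 ^ L0 * L0 ^ 2)%N => d L dL /ltnW LL.
  by rewrite !leq_mul // (leq_trans dL) // leq_exp2l.
exists (2 ^+ e0); split; first exact: exprn_gt0.
move=> d d1; have d0 := ltnW d1.
have /andP[Ld dL] := up_log_bounds (isT : (1 < 2)%N) d1.
set L := up_log 2 d in Ld dL.
have Lgt0 : (0 < L)%N by rewrite lt0n; apply: contraTneq dL => ->; rewrite -ltnNge.
exists (d ^ 2 * d.+1 * 2 ^ cone_exp d L)%N; split; first exact: cpol_admissible_bound.
apply: le_trans (_ : (2 ^ (33 * d * L ^ 2))%:R <= _); first by rewrite ler_nat cpol_bound_exp.
rewrite natrX; set r := Num.sqrt _; have r0 : 0 <= r by exact: sqrtr_ge0.
have [k kE] : exists k : nat, Num.ceil r = k%:Z.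
  by exists `|Num.ceil r|%N; rewrite gez0_abs // ceil_ge0 // (lt_le_trans _ r0) // ltrN10.
rewrite kE -PoszM -exprnP.
have d5 : 1 <= d%:R ^+ 5 :> R by rewrite exprn_ege1 // ler1n.
have K1 : 1 <= 2 ^+ e0 :> R by rewrite exprn_ege1 // ler1n.
have h32 : 1 <= 3 / 2 :> R by lra.
have H n : 1 <= (3 / 2) ^+ n :> R by rewrite exprn_ege1.
have [LL|LL] := ltnP L L0.
  apply: (@le_trans _ _ (2 ^+ e0)); first by rewrite ler_weXn2l ?ler1n // e0P.
  rewrite -mulrA ler_peMr ?(le_trans ler01 K1) //.
  exact: mulr_ege1.
(* As 2 * 132^2 * L^4 <= 2^L and 2^(L-1) < d, the square of 132 L^2 is at most d - 1. *)
have kL : (132 * L ^ 2 <= k)%N.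
  have h : ((132 * L ^ 2) ^ 2 <= d.-1)%N.
    rewrite -ltnS prednK //; apply: leq_ltn_trans Ld.
    rewrite -(leq_pmul2l (isT : 0 < 2)%N) -expnS prednK //.
    by rewrite expnMn -expnM mulnA; exact: L0P.
  rewrite -lez_nat -kE -(ler_int R); apply: le_trans (ceil_ge r).
  rewrite -(@ler_sqr R) ?nnegrE ?ler0z // sqr_sqrtr ?ler0n //.
  by rewrite -[(_ * _)%N%:~R]/((_ * _)%N%:R) -natrX ler_nat.
apply: (@le_trans _ _ ((3 / 2) ^+ (k * d.-1))); last first.
  by rewrite ler_peMl ?(le_trans ler01 (H _)) // mulr_ege1.
apply: (@le_trans _ _ (((3 / 2) ^+ 2) ^+ (33 * d * L ^ 2))).
  by rewrite lerXn2r ?nnegrE ?exprn_ge0 //; lra.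
rewrite -exprM ler_weXn2l //.
apply: (@leq_trans (132 * L ^ 2 * d.-1)); last by rewrite leq_mul2r kL orbT.
have dd : (d <= 2 * d.-1)%N by move: d1; clear; lia.
by move: dd; move: (L ^ 2)%N => s; clear; nia.
Qed.
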